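(* Let $\mu_t^y(B)=\Pr\{\sigma^{f,y}(t)\in B\}$, $t\ge 0$, $B\subseteq[0,\infty)$ Borel, be the transition probabilities of the subordinator $\sigma^{f,y}$ with Laplace exponent $f(\cdot,y)$, and assume that $\mu_t^y\in\mathrm{BO}$ for all $y\in E$. Let $\mu_t^p(B)=\Pr\{\sigma^{f,p}(t)\in B\}$, where $\sigma^{f,p}$ is the corresponding distributed order subordinator. Then $\mu_t^p\in\mathrm{BO}$.
   Context: Setting. $E$ is a Polish space, $W\subseteq E$ is Borel, $p$ is a probability measure on $W$, $Y$ is a random variable with law $p$, and $\mathbb{E}g(Y)=\int_W g(y)\,p(dy)$. For each $y\in E$, $$f(\lambda,y)=a(y)+b(y)\lambda+\int_0^\infty(1-e^{-\lambda s})\,\nu(ds,y),\qquad \lambda>0,$$ is a Bernstein function, where $a(y),b(y)\ge 0$ and $\nu(ds,y)$ is a non-negative $\sigma$-finite measure on $(0,\infty)$ (depending measurably on $y$) with $V(y):=\int_0^\infty (s\wedge 1)\,\nu(ds,y)<\infty$. Standing assumptions. A1) the functions $a,b$ are Borel measurable and either bounded, or such that $\int_W a(y)p(dy)<\infty$ and $\int_W b(y)p(dy)<\infty$. A2) either $V$ is bounded, or $\int_W V(y)p(dy)<\infty$. Under these, $\mathbb{E}f(\lambda,Y)=\mathbb{E}a(Y)+\mathbb{E}b(Y)\lambda+\int_0^\infty(1-e^{-\lambda s})\int_W\nu(ds,y)p(dy)$ is a Bernstein function. Subordinators. $\sigma^{f,y}$ is the (possibly killed, i.e. sent to $\infty$)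 subordinator with $\mathbb{E}e^{-\lambda\sigma^{f,y}(t)}=e^{-tf(\lambda,y)}$. The distributed order subordinator is $\sigma^{f,p}(t)=t\int_W b(y)p(dy)+\sum_{0\le s\le t}\mathbf{e}(s)$, where $\mathbf{e}$ is a Poisson point process with characteristic measure $\int_W(\nu(dx,y)+a(y)\delta_\infty(dx))p(dy)$; equivalently it is the subordinator with $\mathbb{E}e^{-\lambda\sigma^{f,p}(t)}=e^{-t\,\mathbb{E}f(\lambda,Y)}$. Bondesson class. A Bernstein function $g$ is complete if $g(\lambda)=\alpha+\beta\lambda+\int_0^\infty(1-e^{-\lambda s})\,m(s)\,ds$ with $\alpha,\beta\ge0$ and $m$ completely monotone. A sub-probability measure $\mu$ on $[0,\infty)$ belongs to $\mathrm{BO}$ if its Laplace transform is $e^{-g(\lambda)}$ with $g$ a complete Bernstein function. *)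

(* Defs.v *)
From HB Require Import structures.
From mathcomp Require Import all_boot all_order all_algebra.
From mathcomp Require Import all_classical all_reals all_analysis.
From mathcomp Require Import measurable_realfun.

Set Implicit Arguments.
Unset Strict Implicit.
Unset Printing Implicit Defensive.

Import Order.TTheory GRing.Theory Num.Theory.
Import numFieldNormedType.Exports.

Local Open Scope classical_set_scope.
Local Open Scope ring_scope.

Notation borel E := (g_sigma_algebraType (@open E)).

Section polish.
Context {R : realType} {E : topologicalType}.

Definition is_metric (d : E -> E -> R) :=
  [/\ forall x y, 0 <= d x y,
      forall x y, d x y = 0 <-> x = y,
      forall x y, d x y = d y x &
      forall x y z, d x z <= d x y + d y z].

Definition metrizes (d : E -> E -> R) :=
  forall A : set E, open A <->
    forall x, A x -> exists2 r, 0 < r & [set y | d x y < r] `<=` A.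

Definition cauchy_complete (d : E -> E -> R) :=
  forall u : nat -> E,
    (forall r, 0 < r -> exists N, forall i j, (N <= i)%N -> (N <= j)%N ->
       d (u i) (u j) < r) ->
    exists l : E, u @ \oo --> l.

End polish.

Definition polish_space (R : realType) (E : topologicalType) :=
  (exists2 D : set E, countable D & dense D) /\
  exists d : E -> E -> R, [/\ is_metric d, metrizes d & cauchy_complete d].

Section bernstein.
Context {R : realType}.
Local Open Scope ereal_scope.

Definition bernstein_fun (a b : R) (nu : {measure set (measurableTypeR R) -> \bar R})
    (lambda : R) : \bar R :=
  a%:E + (b * lambda)%:E +
  \int[nu]_(s in `]0%R, +oo[) (1 - expR (- (lambda * s)))%:E.

Definition truncated_mean (nu : {measure set (measurableTypeR R) -> \bar R})
    : \bar R :=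
  \int[nu]_(s in `]0%R, +oo[) (Num.min s 1)%:E.

(* Only the values on ]0, +oo[ matter: [m^`(n)] at s > 0 is local. *)
Definition completely_monotone (m : R -> R) :=
  forall (n : nat) (s : R), (0 < s)%R ->
    derivable (m^`(n))%classic s 1%R /\ (0 <= (-1) ^+ n * (m^`(n))%classic s)%R.

(* The integral below is finite because g is real-valued, which encodes the
   Levy condition on m(s)ds. *)
Definition complete_bernstein (g : R -> R) :=
  exists alpha beta m,
    [/\ (0 <= alpha)%R, (0 <= beta)%R, completely_monotone m &
        forall lambda, (0 < lambda)%R ->
          (g lambda)%:E = alpha%:E + (beta * lambda)%:E +
            \int[lebesgue_measure]_(s in `]0%R, +oo[)
              ((1 - expR (- (lambda * s))) * m s)%:E].

Definition BO (mu : {measure set (measurableTypeR R) -> \bar R}) :=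
  [/\ mu `]-oo, 0%R[%classic = 0, mu setT <= 1 &
      exists2 g, complete_bernstein g &
        forall lambda, (0 < lambda)%R ->
          \int[mu]_(x in `[0%R, +oo[) (expR (- (lambda * x)))%:E =
          (expR (- g lambda))%:E].

End bernstein.

Section transition_prob.
Context d (T : measurableType d) (R : realType).
Variables (P : probability T R) (X : {mfun T >-> \bar R}).
Local Open Scope ereal_scope.

(* A random variable in [0, +oo], where +oo is the cemetery, induces the
   sub-probability measure B |-> P (X \in B) on the Borel sets B of [0, +oo[,
   seen here as a measure on R that does not charge ]-oo, 0[. *)
Definition transition_prob (B : set (measurableTypeR R)) : \bar R :=
  P (X @^-1` (EFin @` (B `&` `[0%R, +oo[%classic))).

Let measurable_pre (B : set (measurableTypeR R)) : measurable B ->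
  measurable (X @^-1` (EFin @` (B `&` `[0%R, +oo[%classic))).
Proof.
move=> mB; rewrite -[X in measurable X]setTI.
apply: measurable_funPT => //; apply: measurable_image_EFin.
exact: measurableI.
Qed.

Let transition_prob0 : transition_prob set0 = 0.
Proof. by rewrite /transition_prob set0I image_set0 preimage_set0 measure0. Qed.

Let transition_prob_ge0 B : 0 <= transition_prob B.
Proof. exact: measure_ge0. Qed.

Let transition_prob_sigma_additive : semi_sigma_additive transition_prob.
Proof.
move=> F mF tF mUF.
rewrite /transition_prob setI_bigcupl image_bigcup preimage_bigcup.
apply: measure_semi_sigma_additive.
- by move=> n; exact: measurable_pre.
- apply/trivIsetP => i j _ _ ij.
  rewrite -subset0 => w [[x [Fix _] xw] [y [Fjy _] yw]].
  move: tF => /trivIsetP/(_ i j I I ij); rewrite -subset0; apply.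
  by split; [exact: Fix|move: yw; rewrite -xw => -[<-]].
- rewrite -preimage_bigcup -image_bigcup -setI_bigcupl.
  exact: measurable_pre.
Qed.

HB.instance Definition _ := isMeasure.Build _ _ _ transition_prob
  transition_prob0 transition_prob_ge0 transition_prob_sigma_additive.

End transition_prob.

Section subordinators.
Context d (T : measurableType d) (R : realType) (P : probability T R).
Local Open Scope ereal_scope.

Definition past (sigma : R -> T -> \bar R) (t : R) : set (set T) :=
  <<s [set A | exists u B, [/\ (0 <= u <= t)%R, measurable B &
                               A = sigma u @^-1` B]] >>.

(* Possibly killed subordinator: given that the process is alive at time t
   (sigma t < +oo), the increment over [t, t + s] is independent of the past up
   to t and distributed as sigma s. *)
Definition subordinator (sigma : R -> {mfun T >-> \bar R}) :=
  {ae P, forall w, [/\ sigma 0%R w = 0,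
     forall s t, (0 <= s)%R -> (s <= t)%R -> sigma s w <= sigma t w &
     forall t, (0 <= t)%R -> sigma s w @[s --> t^'+] --> sigma t w]} /\
  forall (s t : R) (A : set T) (B : set (\bar R)),
    (0 <= s)%R -> (0 <= t)%R -> past sigma t A -> measurable B ->
    P (A `&` [set w | sigma t w < +oo] `&`
         [set w | B (sigma (t + s)%R w - sigma t w)]) =
    P (A `&` [set w | sigma t w < +oo]) * P (sigma s @^-1` B).

(* [expeR -oo = 0], so that the event {sigma t = +oo} does not contribute. *)
Definition has_laplace_exponent (sigma : R -> {mfun T >-> \bar R})
    (f : R -> \bar R) :=
  forall t lambda, (0 <= t)%R -> (0 < lambda)%R ->
    \int[P]_w expeR (- (lambda%:E * sigma t w)) = expeR (- (t%:E * f lambda)).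

Definition independent_rvs n (X : 'I_n -> T -> \bar R) :=
  forall B : 'I_n -> set (\bar R), (forall i, measurable (B i)) ->
    P [set w | forall i, B i (X i w)] = \prod_(i < n) P (X i @^-1` B i).

(* [poisson_pmf] is not used because its value at rate 0 is not the Dirac mass
   at 0. *)
Definition poisson_distributed (X : T -> \bar R) (rate : \bar R) :=
  if rate is r%:E then
    forall k : nat, P [set w | X w = k%:R%:E] =
                    (r ^+ k / k`!%:R * expR (- r))%:E
  else P [set w | X w = +oo] = 1.

(* A point process (e s, s >= 0) has marks in ]0, +oo]; the value 0 plays the
   role of the isolated state "no point at time s". *)
Definition point_count (e : R -> T -> \bar R) (A : set (R * \bar R)) (w : T)
    : \bar R :=
  counting [set s : R | [/\ (0 <= s)%R, 0 < e s w & A (s, e s w)]].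

Definition intensity (kappa : set (\bar R) -> \bar R) (A : set (R * \bar R))
    : \bar R :=
  \int[lebesgue_measure]_(s in `[0%R, +oo[) kappa (xsection A s `&` `]0, +oo]%classic).

Definition poisson_point_process (e : R -> T -> \bar R)
    (kappa : set (\bar R) -> \bar R) :=
  [/\ forall s w, 0 <= e s w,
      forall A, measurable A -> measurable_fun setT (point_count e A),
      forall A, measurable A ->
        poisson_distributed (point_count e A) (intensity kappa A) &
      forall n (A : 'I_n -> set (R * \bar R)), (forall i, measurable (A i)) ->
        trivIset setT A -> independent_rvs (fun i => point_count e (A i))].

End subordinators.

Section distributed_order.
Context {R : realType} {E : ptopologicalType}.
Variables (p : probability (borel E) R) (W : set (borel E)).
Variables (a b : borel E -> R).
Variable nu : R.-sigmafker (borel E) ~> (measurableTypeR R).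
Local Open Scope ereal_scope.

Definition mixed_characteristic_measure (B : set (\bar R)) : \bar R :=
  \int[p]_(y in W) (nu y (EFin @^-1` B) + (a y)%:E * \d_(+oo) B).

Definition distributed_order_subordinator d (T : measurableType d)
    (P : probability T R) (sigma : R -> {mfun T >-> \bar R}) :=
  exists2 e : R -> T -> \bar R,
    poisson_point_process P e mixed_characteristic_measure &
    forall t w, (0 <= t)%R ->
      sigma t w = t%:E * (\int[p]_(y in W) (b y)%:E) +
                  \esum_(s in `[0%R, t]) e s w.

End distributed_order.

(* Main.v *)
Require Import Defs.
From HB Require Import structures.
From mathcomp Require Import all_boot all_order all_algebra.
From mathcomp Require Import all_classical all_reals all_analysis.
From mathcomp Require Import measurable_realfun.
From mathcomp Require Import ring lra.

(* By Campbell's formula for the Poisson point process, the law of sigmap t has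
   Laplace exponent t * E f(lambda, Y), and t * f(lambda, y) is a complete
   Bernstein function g_y for every y, so everything reduces to showing that a
   measurable mixture of complete Bernstein functions
     g_y(lambda) = alpha_y + beta_y * lambda + int (1 - e^(-lambda s)) m_y(s) ds
   is complete, with density s |-> E m_Y(s). The Levy-Khintchine triplet of g_y
   need not be compared with (a, b, nu)(y): all that is missing is that m_y(s)
   is measurable in y, and this follows from a Laplace inversion formula giving
   m_y(s) as an iterated limit of combinations of the values g_y(k), k >= 1. *)

Set Implicit Arguments.
Unset Strict Implicit.
Unset Printing Implicit Defensive.

Import Order.TTheory GRing.Theory Num.Theory.
Import numFieldNormedType.Exports.

Local Open Scope classical_set_scope.
Local Open Scope ring_scope.

(** * Completely monotone functions and mixtures of complete Bernstein functions *)

(** The triplets of the g_y are obtained by choice, separately for each y, so nothing is known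
    beforehand about their dependence on y; only g_y(lambda) = t f(lambda, y) is measurable and
    integrable in y. The inversion starts from the fact that g_y(k+2) - g_y(k+1) is the integral of
    e^(-ks) against beta_y delta_0 + e^(-s) (1 - e^(-s)) m_y(s) ds, a finite measure even when m_y
    is not integrable near 0. Hence integrals of polynomials in e^(-s) are measurable in y. The
    polynomials (1 - e^(-ns))^N with N close to n e^(nx) converge boundedly to the indicator of s >
    x, which removes the atom at 0, and differentiating the tail at x isolates the density.
    Integrability is then free: alpha_y, beta_y and m_y(s) are nonnegative and bounded by multiples
    of g_y(1). On the probabilistic side, counts of points and their rates may be infinite, so
    Laplace transforms are computed with values in [0, +oo], where x |-> e^(-x) is continuous up to
    +oo. *)

Lemma cvg_derive1_seq {R : realType} (f : R -> R) (x : R) : derivable f x 1 ->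
  n.+1%:R * (f (n.+1%:R^-1 + x) - f x) @[n --> \oo] --> (derive1 f x : R).
Proof.
move=> df; rewrite derive1E.
have : h^-1 *: ((f \o shift x) (h *: 1) - f x) @[h --> 0^'] --> 'D_1 f x.
  exact: df.
move=> /cvgr_dnbhsP /(_ (fun n => n.+1%:R^-1)) /= h.
rewrite (_ : (fun n => _) =
    (fun n => n.+1%:R^-1^-1 *: (f (n.+1%:R^-1 *: 1 + x) - f x))); last first.
  apply/funext => n; rewrite invrK; congr (_ * (f (_ + x) - _)).
  by rewrite /GRing.scale/= mulr1.
apply: h; split; last exact: cvg_harmonic.
by move=> n; rewrite invr_eq0 pnatr_eq0.
Qed.

(** * Monotonicity and size of the derivatives of a completely monotone function *)

Section completely_monotone.
Context {R : realType}.
Implicit Types (m : R -> R) (n : nat) (s x y : R).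

Lemma completely_monotone_continuous m n s : completely_monotone m -> 0 < s ->
  {for s, continuous (derive1n n m)}.
Proof.
move=> cm s0; have [dm _] := cm n s s0.
by apply: differentiable_continuous; apply/derivable1_diffP.
Qed.

Lemma completely_monotone_ge0 m s : completely_monotone m -> 0 < s -> 0 <= m s.
Proof. by move=> cm s0; have [_] := cm 0%N s s0; rewrite expr0 mul1r. Qed.

Lemma completely_monotone_MVT m n x y : completely_monotone m ->
  0 < x -> x < y -> exists2 c, x < c < y &
    derive1n n m y - derive1n n m x = derive1n n.+1 m c * (y - x).
Proof.
move=> cm x0 xy.
have gt0 z : z \in `[x, y]%R -> 0 < z.
  by rewrite in_itv/= => /andP[xz _]; exact: lt_le_trans xz.
have [z zxy||c cxy ->] := @MVT R (derive1n n m) (derive1n n.+1 m) x y xy.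
- have z0 : 0 < z by move: zxy; rewrite in_itv/= => /andP[/(lt_trans x0)].
  have [dm _] := cm n z z0; apply: DeriveDef => //.
  by rewrite derive1nS derive1E.
- apply: continuous_in_subspaceT => z; rewrite inE => /gt0 z0.
  exact: completely_monotone_continuous.
- by exists c => //; rewrite in_itv/= in cxy.
Qed.

Lemma completely_monotone_nonincr m n x y : completely_monotone m ->
  0 < x -> x <= y ->
  (-1) ^+ n * derive1n n m y <= (-1) ^+ n * derive1n n m x.
Proof.
move=> cm x0; rewrite le_eqVlt => /predU1P[->//|xy].
have [c /andP[xc cy] e] := completely_monotone_MVT n cm x0 xy.
rewrite -subr_le0 -mulrBr e mulrA pmulr_lle0 ?subr_gt0//.
have [_] := cm n.+1 c (lt_trans x0 xc).
by rewrite exprS mulN1r mulNr oppr_ge0.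
Qed.

Lemma completely_monotone_abs m n s : completely_monotone m -> 0 < s ->
  `|derive1n n m s| = (-1) ^+ n * derive1n n m s.
Proof.
move=> cm s0; have [_ ge0] := cm n s s0.
by rewrite -[RHS]ger0_norm// normrM normrX normrN1 expr1n mul1r.
Qed.

Lemma completely_monotone_abs_nonincr m n x y : completely_monotone m ->
  0 < x -> x <= y -> `|derive1n n m y| <= `|derive1n n m x|.
Proof.
move=> cm x0 xy; have y0 := lt_le_trans x0 xy.
by rewrite !completely_monotone_abs//; exact: completely_monotone_nonincr.
Qed.

(** The mean value theorem on [s/2, s] gives c with |m^(n+1)(c)| s/2 at most |m^(n)(s/2)|, because
    (-1)^n m^(n) is nonnegative and nonincreasing; monotonicity of |m^(n+1)| carries the bound from
    c to s. This lets integrability in a parameter pass from one derivative to the next. *)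
Lemma completely_monotone_deriv_le m n s : completely_monotone m -> 0 < s ->
  `|derive1n n.+1 m s| <= 2 / s * `|derive1n n m (s / 2)|.
Proof.
move=> cm s0; have s20 : 0 < s / 2 by rewrite divr_gt0.
have s2s : s / 2 < s by rewrite ltr_pdivrMr// ltr_pMr// ltr1n.
have [c /andP[xc cy] e] := completely_monotone_MVT n cm s20 s2s.
have c0 := lt_trans s20 xc.
have := completely_monotone_abs_nonincr n.+1 cm c0 (ltW cy).
move=> /le_trans; apply.
have : `|derive1n n.+1 m c| * (s / 2) <= `|derive1n n m (s / 2)|.
  have sE : s / 2 = s - s / 2 by lra.
  rewrite -[X in _ * X <= _]ger0_norm ?(ltW s20)// [X in _ * `|X| <= _]sE.
  rewrite -normrM -e !completely_monotone_abs//.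
  have [_ ge0] := cm n s s0.
  have le := completely_monotone_nonincr n cm s20 (ltW s2s).
  have -> (u : R) : `|u| = `|(-1) ^+ n * u|.
    by rewrite normrM normrX normrN1 expr1n mul1r.
  by rewrite mulrBr distrC ger0_norm ?subr_ge0// lerBlDr lerDl.
rewrite -ler_pdivlMr// => /le_trans; apply.
by rewrite invf_div mulrC.
Qed.

End completely_monotone.

(** * Polynomials in e^(-s) approximating a step function *)

Section step_approximation.
Context {R : realType}.
Implicit Types (x s : R) (n : nat).

Definition step_exponent x n : nat := Num.truncn (n%:R * expR (n%:R * x)).

(* The exponent is about n e^(nx), so that the approximant is close to
   exp(- n e^(n (x - s))): it tends to 0 also at s = x, by the extra factor n. *)
Definition step_approx x n : {poly R} := (1 - 'X^n) ^+ step_exponent x n.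

Lemma step_approxE x n s :
  (step_approx x n).[expR (- s)] = (1 - expR (- (n%:R * s))) ^+ step_exponent x n.
Proof.
rewrite /step_approx horner_exp hornerD hornerN hornerXn hornerC.
by rewrite -expRM_natl mulrN.
Qed.

Lemma expR_oppr01 s : 0 <= s -> 0 <= 1 - expR (- s) <= 1.
Proof.
move=> s0; rewrite subr_ge0 gerBl expR_ge0 andbT.
by rewrite expR_le1 oppr_le0.
Qed.

Lemma step_approx01 x n s : 0 <= s -> 0 <= (step_approx x n).[expR (- s)] <= 1.
Proof.
move=> s0; have /andP[h0 h1] : 0 <= 1 - expR (- (n%:R * s)) <= 1.
  by apply: expR_oppr01; rewrite mulr_ge0.
by rewrite step_approxE exprn_ge0// exprn_ile1.
Qed.

Lemma bernoulli_inequality (v : R) k : 0 <= v <= 1 -> 1 - k%:R * v <= (1 - v) ^+ k.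
Proof.
move=> /andP[v0 v1]; elim: k => [|k ih]; first by rewrite mul0r subr0 expr0.
rewrite exprS.
have : (1 - v) * (1 - k%:R * v) <= (1 - v) * (1 - v) ^+ k.
  by rewrite ler_wpM2l// subr_ge0.
apply: le_trans; rewrite -[in X in X <= _]natr1.
have : 0 <= k%:R * v * v by rewrite !mulr_ge0.
lra.
Qed.

(** The product of (1 - v)^k and (1 + v)^k is (1 - v^2)^k, at most 1, and (1 + v)^k is at least 1 +
    k v. *)
Lemma expr_onem_le (v : R) k : 0 <= v <= 1 -> (1 - v) ^+ k <= (1 + k%:R * v)^-1.
Proof.
move=> /andP[v0 v1]; have kv : 0 <= k%:R * v by rewrite mulr_ge0.
rewrite -[leRHS]mul1r ler_pdivlMr; last by lra.
have le1 : 1 + k%:R * v <= (1 + v) ^+ k.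
  elim: k {kv} => [|k ih]; first by rewrite mul0r addr0 expr0.
  rewrite exprS.
  have : (1 + v) * (1 + k%:R * v) <= (1 + v) * (1 + v) ^+ k.
    by rewrite ler_wpM2l//; lra.
  apply: le_trans; rewrite -[in X in X <= _]natr1.
  have : 0 <= k%:R * v * v by rewrite !mulr_ge0.
  lra.
apply: (@le_trans _ _ ((1 - v) ^+ k * (1 + v) ^+ k)).
  by rewrite ler_wpM2l// exprn_ge0// subr_ge0.
rewrite -exprMn exprn_ile1//; first by rewrite mulr_ge0; lra.
have : 0 <= v * v by rewrite mulr_ge0.
lra.
Qed.

(** With N the exponent and v = e^(-ns), (N + 1) v is at least n e^(n (x - s)), hence at least n.
    Since v is at most 1, the denominator 1 + N v of [expr_onem_le] absorbs what truncation
    loses. *)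
Lemma step_approx_le x n s : (0 < n)%N -> 0 <= s -> s <= x ->
  (step_approx x n).[expR (- s)] <= n%:R^-1.
Proof.
move=> n0 s0 sx; rewrite step_approxE.
have ns : 0 <= n%:R * s by rewrite mulr_ge0.
have v01 : 0 <= expR (- (n%:R * s)) <= 1.
  by rewrite expR_ge0/= expR_le1 oppr_le0.
apply: (le_trans (expr_onem_le _ v01)).
have den_gt0 : 0 < 1 + (step_exponent x n)%:R * expR (- (n%:R * s)).
  by rewrite ltr_wpDr// mulr_ge0// expR_ge0.
rewrite lef_pV2 ?posrE ?ltr0n//.
have hN : n%:R * expR (n%:R * x) <= (step_exponent x n)%:R + 1 :> R.
  by rewrite natr1 ltW// /step_exponent -truncn_lt_nat// mulr_ge0// expR_ge0.
case/andP: v01 => v0 v1.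
have : n%:R * expR (n%:R * x) * expR (- (n%:R * s)) <=
       ((step_exponent x n)%:R + 1) * expR (- (n%:R * s)) by rewrite ler_wpM2r.
rewrite -mulrA -expRD => h.
have : n%:R * 1 <= n%:R * expR (n%:R * x + - (n%:R * s)) :> R.
  by rewrite ler_wpM2l// -[X in X <= _]expR0 ler_expR subr_ge0 ler_wpM2l.
lra.
Qed.

(** Bernoulli's inequality leaves the error n e^(-z) with z = n (s - x). The quadratic bound e^z >=
    z^2 / 2 is used because a linear one would only just compensate the factor n and give no
    convergence. *)
Lemma step_approx_ge x n s : (0 < n)%N -> 0 <= x -> x < s ->
  1 - 2 / (n%:R * (s - x) ^+ 2) <= (step_approx x n).[expR (- s)].
Proof.
move=> n0 x0 xs; rewrite step_approxE.
have s0 : 0 <= s by rewrite (le_trans x0)// ltW.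
have ns : 0 <= n%:R * s by rewrite mulr_ge0.
have v01 : 0 <= expR (- (n%:R * s)) <= 1.
  by rewrite expR_ge0/= expR_le1 oppr_le0.
apply: le_trans (bernoulli_inequality _ v01).
rewrite lerB//.
have hN : (step_exponent x n)%:R <= n%:R * expR (n%:R * x) :> R.
  by rewrite /step_exponent truncn_le// mulr_ge0// expR_ge0.
case/andP: v01 => v0 v1.
apply: (le_trans (ler_wpM2r v0 hN)).
rewrite -mulrA -expRD.
have -> : n%:R * x + - (n%:R * s) = - (n%:R * (s - x)) :> R by ring.
set z := n%:R * (s - x).
have z0 : 0 < z by rewrite mulr_gt0 ?ltr0n ?subr_gt0.
have := @expR_ge1Dxn R z 1 (ltW z0); rewrite (_ : 2`! = 2)%N// => h.
have z2 : 0 < z ^+ 2 / 2%:R by rewrite divr_gt0// exprn_gt0.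
have : expR (- z) <= (z ^+ 2 / 2%:R)^-1.
  by rewrite expRN lef_pV2 ?posrE ?expR_gt0//; lra.
move=> /(ler_wpM2l (ler0n R n)) /le_trans; apply.
rewrite le_eqVlt; apply/orP; left; apply/eqP.
rewrite /z; field.
by rewrite pnatr_eq0 -lt0n n0 subr_eq0 (gt_eqF xs).
Qed.

Lemma cvg_invn : n%:R^-1 @[n --> \oo] --> (0 : R).
Proof. by rewrite -cvg_shiftS; exact: cvg_harmonic. Qed.

Lemma cvg_step_approx x s : 0 <= x -> 0 <= s ->
  (step_approx x n).[expR (- s)] @[n --> \oo] --> ((x < s)%R%:R : R).
Proof.
move=> x0 s0; have [xs|sx] := ltP x s.
  apply: (@squeeze_cvgr _ _ _ _ (fun n => 1 - 2 / (n%:R * (s - x) ^+ 2)) (cst 1)).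
  - near=> n; have n0 : (0 < n)%N by near: n; exact: nbhs_infty_gt.
    rewrite step_approx_ge//=.
    by have /andP[] := step_approx01 x n s0.
  - rewrite -[X in _ --> X]subr0; apply: cvgB; first exact: cvg_cst.
    rewrite -[X in _ --> X](mulr0 (2 / (s - x) ^+ 2)).
    under eq_fun do rewrite invfM mulrA (mulrAC 2).
    by apply: cvgMr; exact: cvg_invn.
  - exact: cvg_cst.
apply: (@squeeze_cvgr _ _ _ _ (cst 0) (fun n => n%:R^-1)).
- near=> n; have n0 : (0 < n)%N by near: n; exact: nbhs_infty_gt.
  rewrite step_approx_le// andbT.
  by have /andP[] := step_approx01 x n s0.
- exact: cvg_cst.
- exact: cvg_invn.
Unshelve. all: by end_near. Qed.

End step_approximation.

(** * Laplace inversion: measurability of a density in a parameter *)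

Section bounded_times_integrable.
Context {R : realType}.
Local Notation mu := (@lebesgue_measure R).
Local Notation D := (`]0, +oo[%classic : set R).
Implicit Types (phi w : R -> R).

Lemma integrable_boundedM phi w (M : R) : measurable_fun D phi ->
  (forall s, 0 <= s -> `|phi s| <= M) -> mu.-integrable D (EFin \o w) ->
  mu.-integrable D (EFin \o (fun s => phi s * w s)).
Proof.
move=> mphi phiM iw.
have mw : measurable_fun D w by have /integrableP[/measurable_EFinP] := iw.
apply: (@le_integrable _ _ _ mu D _ _ (fun s => M%:E * (w s)%:E)%E) => //.
- exact/measurable_EFinP/measurable_funM.
- move=> s /=; rewrite in_itv/= andbT => s0.
  by rewrite lee_fin !normrM ler_wpM2r// (le_trans (phiM _ (ltW s0)))// ler_norm.
- exact: integrableZl.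
Qed.

Lemma cvg_Rintegral_boundedM (phi_ : (R -> R)^nat) phi w (M : R) :
  (forall n, measurable_fun D (phi_ n)) ->
  (forall n s, 0 <= s -> `|phi_ n s| <= M) ->
  (forall s, 0 < s -> phi_ n s @[n --> \oo] --> phi s) ->
  mu.-integrable D (EFin \o w) ->
  (\int[mu]_(s in D) (phi_ n s * w s))%R @[n --> \oo] -->
  (\int[mu]_(s in D) (phi s * w s))%R.
Proof.
move=> mphi_ phiM cphi iw.
have mw : measurable_fun D w by have /integrableP[/measurable_EFinP] := iw.
have mphi : measurable_fun D phi.
  by apply: (measurable_fun_cvg mphi_) => s /=; rewrite in_itv/= andbT => /cphi.
have M0 : 0 <= M by apply: le_trans (phiM 0%N 0 (lexx _)).
have [] := @dominated_convergence _ _ _ mu D (measurable_itv _)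
  (fun n s => (phi_ n s * w s)%:E) (fun s => (phi s * w s)%:E)
  (fun s => M%:E * `|(w s)%:E|)%E.
- by move=> n; apply/measurable_EFinP/measurable_funM => //; exact: mphi_.
- exact/measurable_EFinP/measurable_funM.
- apply: aeW => s /=; rewrite in_itv/= andbT => s0.
  apply: cvg_EFin; first exact: nearW.
  by apply: cvgMl; exact: cphi.
- by apply: integrableZl => //; exact: integrable_abse.
- apply: aeW => s n /=; rewrite in_itv/= andbT => s0.
  by rewrite lee_fin normrM ler_wpM2r// phiM// ltW.
move=> iphi _ cvg; apply: fine_cvg; rewrite fineK//.
exact: (@integrable_fin_num _ _ _ mu D).
Qed.

End bounded_times_integrable.

Section measurable_density.
Context {R : realType} d (T : measurableType d).
Local Notation mu := (@lebesgue_measure R).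
Local Notation D := (`]0, +oo[%classic : set R).
Context (beta : T -> R) (w : T -> R -> R).
Context (iw : forall y, mu.-integrable D (EFin \o w y)).

(** The integral of phi against the measure beta y delta_0 + w y s ds. The atom accounts for the
    linear coefficient of the Bernstein function, whose measurability in y is not known at this
    stage. *)
Let J (phi : R -> R) y : R := beta y * phi 0 + \int[mu]_(s in D) (phi s * w y s).

Let good (phi : R -> R) := [/\ measurable_fun D phi,
  exists M : R, forall s : R, 0 <= s -> `|phi s| <= M & measurable_fun setT (J phi)].

Let good_lin (c : R) phi psi : good phi -> good psi ->
  good (fun s => c * phi s + psi s).
Proof.
move=> [mphi [M phiM] Jphi] [mpsi [N psiN] Jpsi]; split.
- by apply: measurable_funD => //; exact: measurable_funM.
- exists (`|c| * M + N) => s s0; rewrite (le_trans (ler_normD _ _))// lerD ?psiN//.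
  by rewrite normrM ler_wpM2l// phiM.
- rewrite (_ : J _ = (fun y => c * J phi y + J psi y)).
    by apply: measurable_funD => //; exact: measurable_funM.
  apply/funext => y; rewrite /J.
  have iphi := integrable_boundedM mphi phiM (iw y).
  have ipsi := integrable_boundedM mpsi psiN (iw y).
  under [in LHS]eq_Rintegral do rewrite mulrDl -mulrA.
  rewrite RintegralD// ?RintegralZl//; first by ring.
  exact: (@integrableZl _ _ _ mu D _ c _ iphi).
Qed.

Hypothesis good_expR : forall k, measurable_fun setT (J (fun s => expR (- s) ^+ k)).

Let good_poly (q : {poly R}) : good (fun s => q.[expR (- s)]).
Proof.
under eq_fun do rewrite horner_coef.
elim: (size q) => [|k ih].
  rewrite (_ : (fun s => _) = cst 0); last by apply/funext => s; rewrite big_ord0.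
  split; [by []|by exists 0 => s _; rewrite normr0|].
  rewrite (_ : J _ = cst 0)//; apply/funext => y; rewrite /J mulr0 add0r.
  by under eq_Rintegral do rewrite mul0r; rewrite /Rintegral integral0.
under eq_fun do rewrite big_ord_recr/= addrC.
apply: good_lin => //; split.
- by apply/measurable_funX/measurableT_comp/measurable_funN.
- exists 1 => s s0; rewrite normrX exprn_ile1// ger0_norm ?expR_ge0//.
  by rewrite expR_le1 oppr_le0.
- exact: good_expR.
Qed.

(** Because of the atom, the approximants must converge at s = 0 too, also when x = 0; this is the
    case s = x in which they tend to 0. *)
Let J_step x : 0 <= x -> measurable_fun setT (J (fun s => (x < s)%R%:R)).
Proof.
move=> x0.
apply: (@measurable_fun_cvg _ _ _ _
  (fun n => J (fun s => (step_approx x n).[expR (- s)]))).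
  by move=> n; have [] := good_poly (step_approx x n).
move=> y _; apply: cvgD.
  by apply: cvgMr; exact: cvg_step_approx.
apply: (@cvg_Rintegral_boundedM _ _ _ _ 1) => //.
- by move=> n; have [] := good_poly (step_approx x n).
- move=> n s s0; have /andP[h0 h1] := step_approx01 x n s0.
  by rewrite ger0_norm.
- by move=> s s0; apply: cvg_step_approx => //; exact: ltW.
Qed.

Lemma measurable_density x : 0 < x -> (forall y, {for x, continuous (w y)}) ->
  measurable_fun setT (w ^~ x).
Proof.
move=> x0 cw.
have x20 : 0 <= x / 2 by rewrite divr_ge0// ltW.
have x2x : x / 2 < x by rewrite ltr_pdivrMr// ltr_pMr// ltr1n.
(* For u >= 0 the indicator of s > u vanishes at 0, so the atom no longer contributes and only
   integrals of the density remain. *)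
have JB u v y : 0 <= u -> u <= v ->
    J (fun s => (u < s)%R%:R) y - J (fun s => (v < s)%R%:R) y =
    \int[mu]_(s in `]u, v]) w y s.
  move=> u0 uv; have v0 := le_trans u0 uv.
  rewrite /J [u < 0]ltNge [v < 0]ltNge u0 v0/= !mulr0 !add0r.
  have subD z : 0 <= z -> `]z, +oo[ `<=` D.
    by move=> z0 s /=; rewrite !in_itv/= !andbT; exact: le_lt_trans.
  have tailE z : 0 <= z -> \int[mu]_(s in D) ((z < s)%R%:R * w y s) =
      \int[mu]_(s in `]z, +oo[) w y s.
    move=> /subD zD; rewrite -[in RHS](setIidr zD).
    rewrite Rintegral_mkcondr; apply: eq_Rintegral => s _.
    rewrite patchE mem_setE in_itv/= andbT.
    by case: (z < s); rewrite ?mul0r ?mul1r.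
  have iu : mu.-integrable `]u, +oo[ (EFin \o w y).
    by apply: (@integrableS _ _ _ mu D) => //; exact: subD.
  by rewrite !tailE// -(Rintegral_itvB (x := v) iu)// opprB addrC subrK.
(* A primitive of [w y] around x, based at x / 2: its difference quotients along 1 / (n + 1) are
   measurable in y by [JB] and converge to [w y x] by continuity at x. *)
pose F y z := \int[mu]_(s in `]x / 2, z]) w y s.
apply: (@measurable_fun_cvg _ _ _ _
  (fun n y => n.+1%:R * (F y (n.+1%:R^-1 + x) - F y x))).
  move=> n; apply: measurable_funM => //.
  have xn : x <= n.+1%:R^-1 + x by rewrite lerDr.
  rewrite /F; under eq_fun do rewrite -!JB ?(ltW x2x)// ?(le_trans (ltW x2x))//.
  by do 2?apply: measurable_funB; apply: J_step => //; rewrite ?(le_trans _ xn)// ltW.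
move=> y _.
have [||||dF <-] := @continuous_FTC1 R (w y) (BRight (x / 2)) x (x + 1).
- by rewrite ltrDl.
- apply: (@integrableS _ _ _ mu D) => // s /=; rewrite !in_itv/= andbT.
  by move=> /andP[+ _]; exact: le_lt_trans.
- exact: x2x.
- exact: cw.
exact: cvg_derive1_seq.
Qed.

End measurable_density.

(** * Joint measurability from measurable sections and continuity *)

Section caratheodory_function.
Context {R : realType} d (T : measurableType d).
Local Notation D := (`]0, +oo[%classic : set R).

(** The successor keeps every grid point in ]0, +oo[, where the sections are measurable; for s < 0
    the truncation is 0, whence the maximum in the limit. *)
Lemma cvg_truncn_grid (s : R) :
  (Num.truncn (n.+1%:R * s)).+1%:R / n.+1%:R @[n --> \oo] --> Num.max s 0.
Proof.
apply: (@squeeze_cvgr _ _ _ _ (cst (Num.max s 0))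
  (fun n => Num.max s 0 + n.+1%:R^-1)).
- near=> n; rewrite ler_pdivlMr// ler_pdivrMr// mulrDl mulVf ?pnatr_eq0//.
  have [s0|s0] := ltP s 0.
    rewrite !mul0r add0r ler0n/= (_ : Num.truncn _ = 0)%N//.
    by apply/truncn0Pn; rewrite -ltNge (le_lt_trans _ ltr01)// pmulr_rle0// ltW.
  rewrite mulrC ltW/= ?truncnS_gt//.
  by rewrite -natr1 lerD2r truncn_le mulr_ge0.
- exact: cvg_cst.
- by rewrite -[X in _ --> X]addr0; apply: cvgD; [exact: cvg_cst|exact: cvg_harmonic].
Unshelve. all: by end_near. Qed.

(* The section at s is the pointwise limit of the sections on the grid n^-1 N. *)
Lemma measurable_fun_caratheodory (f : T -> R -> R) :
  (forall s, 0 < s -> measurable_fun setT (f ^~ s)) ->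
  (forall y s, 0 < s -> {for s, continuous (f y)}) ->
  measurable_fun (setT `*` D) (fun z : T * measurableTypeR R => f z.1 z.2).
Proof.
move=> mf cf.
have mD : measurable (setT `*` D : set (T * measurableTypeR R)) by exact: measurableX.
apply: (@measurable_fun_cvg _ _ _ _
  (fun n (z : T * measurableTypeR R) => f z.1 ((Num.truncn
    (n.+1%:R * z.2)).+1%:R / n.+1%:R))); last first.
  move=> z [_ /=]; rewrite in_itv/= andbT => s0.
  apply: continuous_cvg; first exact: cf.
  by have := @cvg_truncn_grid z.2; rewrite max_l// ltW.
move=> n; apply: (measurable_funS measurableT) => //.
move=> _ B mB; rewrite setTI.
pose tr k := [set s : R | Num.truncn (n.+1%:R * s) = k].
have mtr k : measurable (tr k : set (measurableTypeR R)).
  have mh : measurable_fun setT (fun s : R => (Num.truncn (n.+1%:R * s))%:R : R).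
    apply: nondecreasing_measurable => // r s rs.
    by rewrite ler_nat; apply: le_truncn; rewrite ler_wpM2l.
  rewrite (_ : tr k = (fun s : R => (Num.truncn (n.+1%:R * s))%:R
    : R) @^-1` [set k%:R]).
    by rewrite -[X in measurable X]setTI; exact: mh.
  by apply/seteqP; split => [s /= ->//|s /= /eqP]; rewrite eqr_nat => /eqP.
rewrite (_ : _ @^-1` B = \bigcup_k ((@snd T (measurableTypeR R) @^-1` tr k) `&`
    ((fun z : T * measurableTypeR R => f z.1 (k.+1%:R / n.+1%:R)) @^-1` B))).
  apply: bigcupT_measurable => k; apply: measurableI.
    by rewrite -[X in measurable X]setTI; exact: measurable_snd.
  have mfk : measurable_fun setT (f ^~ (k.+1%:R / n.+1%:R)) by exact/mf/divr_gt0.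
  by rewrite -[X in measurable X]setTI; exact: (measurableT_comp mfk measurable_fst).
apply/seteqP; split => [z Bz|z [k _ [/= <-//]]].
by exists (Num.truncn (n.+1%:R * z.2)).
Qed.

End caratheodory_function.

(** * Mixtures of completely monotone functions *)

Section completely_monotone_mixture.
Context {R : realType} d (T : measurableType d).
Context (mu : {measure set T -> \bar R}) (m : T -> R -> R).
Hypothesis cm : forall y, completely_monotone (m y).
Hypothesis im : forall s : R, 0 < s -> mu.-integrable setT (EFin \o m ^~ s).

(** By induction on n: the derivative of order n + 1 at s is dominated by a multiple of the one of
    order n at s / 2, and it is measurable in y as a limit of difference quotients along a
    sequence. *)
Let idm n s : 0 < s -> mu.-integrable setT (fun y => (derive1n n (m y) s)%:E).
Proof.
elim: n s => [|n ih] s s0; first exact: im.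
have mn r : 0 < r -> measurable_fun setT (fun y => derive1n n (m y) r).
  by move=> /ih /integrableP[/measurable_EFinP].
have s20 : 0 < s / 2 by exact: divr_gt0.
apply: (@le_integrable _ _ _ mu _ _ _
    (fun y => (2 / s)%:E * (derive1n n (m y) (s / 2))%:E)%E) => //.
- apply/measurable_EFinP; apply: (@measurable_fun_cvg _ _ _ _ (fun k y =>
    k.+1%:R * (derive1n n (m y) (k.+1%:R^-1 + s) - derive1n n (m y) s))).
    by move=> k; apply: measurable_funM => //; apply: measurable_funB;
      apply: mn => //; exact: addr_gt0.
  by move=> y _; rewrite derive1nS; apply: cvg_derive1_seq; have [] := cm y n s0.
- move=> y _ /=; rewrite lee_fin normrM ger0_norm; last by rewrite divr_ge0 ?ltW.
  exact: completely_monotone_deriv_le.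
- by apply: integrableZl => //; exact: ih.
Qed.

(** Differentiation under the integral sign on ]s/2, s + 1[. As |m^(n+1)| is nonincreasing, its
    value at the left end s / 2 dominates the derivative uniformly on that interval. *)
Let dm n s : 0 < s ->
  derivable (fun r => \int[mu]_y derive1n n (m y) r) s 1 /\
  derive1 (fun r => \int[mu]_y derive1n n (m y) r) s =
    \int[mu]_y derive1n n.+1 (m y) s.
Proof.
move=> s0; have s20 : 0 < s / 2 by exact: divr_gt0.
have Is : `]s / 2, s + 1[%classic s.
  by rewrite /= in_itv/= ltrDl ltr01 andbT ltr_pdivrMr// ltr_pMr// ltr1n.
have I0 r : `]s / 2, s + 1[%classic r -> 0 < r.
  by rewrite /= in_itv/= => /andP[/(lt_trans s20)].
have i1 r : `]s / 2, s + 1[%classic r ->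
    mu.-integrable setT (EFin \o (fun y => derive1n n (m y) r)).
  by move=> /I0; exact: idm.
have d1 r y : `]s / 2, s + 1[%classic r -> setT y ->
    derivable (fun r => derive1n n (m y) r) r 1.
  by move=> /I0 r0 _; have [] := cm y n r0.
have iG : mu.-integrable setT (EFin \o (fun y => `|derive1n n.+1 (m y) (s / 2)|)).
  exact: (integrable_norm (idm n.+1 s20)).
have Gub r y : `]s / 2, s + 1[%classic r -> setT y ->
    `|partial1of2 (fun r y => derive1n n (m y) r) r y| <=
    `|derive1n n.+1 (m y) (s / 2)|.
  move=> Ir _; apply: (@completely_monotone_abs_nonincr R (m y) n.+1 (s / 2) r) => //.
  by move: Ir; rewrite /= in_itv/= => /andP[/ltW].
have G0 y : 0 <= `|derive1n n.+1 (m y) (s / 2)| by [].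
split.
  exact: (derivable_under_integral measurableT Is i1 d1 G0 iG Gub).
exact: (differentiation_under_integral measurableT Is i1 d1 G0 iG Gub).
Qed.

Lemma derive1n_Rintegral n s : 0 < s ->
  derive1n n (fun r => \int[mu]_y m y r) s = \int[mu]_y derive1n n (m y) s.
Proof.
elim: n s => [|n ih] s s0; first by [].
rewrite derive1nS -(dm n s0).2 !derive1E; apply: near_eq_derive.
by near=> r; apply: ih; near: r; exact: lt_nbhsr.
Unshelve. all: by end_near. Qed.

Lemma completely_monotone_Rintegral :
  completely_monotone (fun r => \int[mu]_y m y r).
Proof.
move=> n s s0; split.
  apply: near_eq_derivable (dm n s0).1.
  by near=> r; rewrite derive1n_Rintegral//; near: r; exact: lt_nbhsr.
rewrite derive1n_Rintegral// -RintegralZl//; last exact: idm.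
by apply: Rintegral_ge0 => y _; have [] := cm y n s0.
Unshelve. all: by end_near. Qed.

End completely_monotone_mixture.

(** * Bounds drawn from a single complete Bernstein representation *)

Section complete_bernstein_representation.
Context {R : realType}.
Local Notation leb := (@lebesgue_measure R).
Local Notation D := (`]0, +oo[%classic : set R).
Context (g : R -> R) (alpha beta : R) (m : R -> R).
Hypothesis alpha_ge0 : 0 <= alpha.
Hypothesis beta_ge0 : 0 <= beta.
Hypothesis cm : completely_monotone m.
Hypothesis gE : forall lambda, 0 < lambda ->
  ((g lambda)%:E = alpha%:E + (beta * lambda)%:E +
    \int[leb]_(s in D) ((1 - expR (- (lambda * s))) * m s)%:E)%E.

Lemma levy_integrand_ge0 (lambda s : R) : 0 < lambda -> 0 < s ->
  0 <= (1 - expR (- (lambda * s))) * m s.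
Proof.
move=> l0 s0; apply: mulr_ge0; last exact: completely_monotone_ge0.
by rewrite subr_ge0 expR_le1 oppr_le0 mulr_ge0// ltW.
Qed.

Lemma measurable_completely_monotone : measurable_fun D m.
Proof.
apply: open_continuous_measurable_fun; first exact: interval_open.
by move=> s; rewrite inE/= in_itv/= andbT => s0;
  exact: (@completely_monotone_continuous _ _ 0%N _ cm s0).
Qed.

Lemma measurable_levy_integrand lambda :
  measurable_fun D (fun s => (1 - expR (- (lambda * s))) * m s).
Proof.
apply: measurable_funM; last exact: measurable_completely_monotone.
apply: measurable_funB => //; apply: measurableT_comp => //.
by apply: measurable_funN; exact: measurable_funM.
Qed.

(** The left side of [gE] is a real number, which excludes an infinite integral. *)
Lemma levy_integral lambda : 0 < lambda ->
  (\int[leb]_(s in D) ((1 - expR (- (lambda * s))) * m s)%:E =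
   (g lambda - (alpha + beta * lambda))%:E)%E.
Proof.
move=> /gE; case: (integral _ _ _) => [r /= [->]|//|//].
by congr (_%:E); ring.
Qed.

Lemma integrable_levy_integrand lambda : 0 < lambda -> leb.-integrable D
  (EFin \o (fun s => (1 - expR (- (lambda * s))) * m s)).
Proof.
move=> l0; apply/integrableP; split.
  by apply/measurable_EFinP; exact: measurable_levy_integrand.
rewrite [X in (X < _)%E](_ : _ =
    \int[leb]_(s in D) ((1 - expR (- (lambda * s))) * m s)%:E)%E.
  by rewrite levy_integral// ltry.
apply: eq_integral => s; rewrite inE/= in_itv/= andbT => s0.
by rewrite ger0_norm// levy_integrand_ge0.
Qed.

(** On ]s/2, s], of length s / 2, the integrand at lambda = 1 is at least (1 - e^(-s/2)) m(s), since
    m is nonincreasing. This domination by g(1) makes m_y(s) integrable in y. *)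
Lemma density_le s : 0 < s ->
  m s <= ((1 - expR (- (s / 2))) * (s / 2))^-1 * g 1.
Proof.
move=> s0; have s20 : 0 < s / 2 by exact: divr_gt0.
have c0 : 0 < (1 - expR (- (s / 2))) * (s / 2).
  by rewrite mulr_gt0// subr_gt0 expR_lt1 oppr_lt0.
pose J := `]s / 2, s]%classic.
have mJ : measurable (J : set (measurableTypeR R)) by exact: measurable_itv.
have lJ : leb J = (s / 2)%:E.
  rewrite /J lebesgue_measure_itv/= lte_fin ltr_pdivrMr// ltr_pMr// ltr1n.
  by rewrite -EFinD (_ : s - s / 2 = s / 2)//; lra.
have sD : J `<=` D.
  by move=> r; rewrite /J/= !in_itv/= andbT => /andP[/(lt_trans s20)].
rewrite ler_pdivlMl// -lee_fin.
apply: (@le_trans _ _ (\int[leb]_(r in D) ((1 - expR (- (1 * r))) * m r)%:E)%E).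
  apply: (@le_trans _ _ (\int[leb]_(r in J) ((1 - expR (- (1 * r))) * m r)%:E)%E).
    apply: (@le_trans _ _ (\int[leb]_(r in J) ((1 - expR (- (s / 2))) * m s)%:E)%E).
      rewrite integral_cst// [X in (_ * X)%E]lJ -EFinM lee_fin. by rewrite mulrAC lexx.
    apply: ge0_le_integral => //.
    - move=> r _; rewrite lee_fin; apply: mulr_ge0; last exact: completely_monotone_ge0.
      by rewrite subr_ge0 expR_le1 oppr_le0 ltW.
    - apply/measurable_EFinP; apply: (measurable_funS _ sD) => //.
      exact: measurable_levy_integrand.
    - move=> r; rewrite /J/= in_itv/= => /andP[sr rs].
      have r0 : 0 < r by exact: lt_trans sr.
      rewrite lee_fin mul1r; apply: ler_pM.
      + by rewrite subr_ge0 expR_le1 oppr_le0 ltW.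
      + exact: completely_monotone_ge0.
      + by rewrite lerB// ler_expR lerN2 ltW.
      + have := completely_monotone_nonincr 0%N cm r0 rs.
        by rewrite !expr0 !mul1r.
  apply: ge0_subset_integral => //.
    by apply/measurable_EFinP; exact: measurable_levy_integrand.
  by move=> r /=; rewrite in_itv/= andbT => r0; rewrite lee_fin levy_integrand_ge0.
by rewrite levy_integral// lee_fin mulr1 gerBl addr_ge0.
Qed.

End complete_bernstein_representation.

(** * Mixtures of complete Bernstein functions *)

Section complete_bernstein_mixture.
Context {R : realType} d (T : measurableType d).
Context (mu : {sigma_finite_measure set T -> \bar R}).
Local Notation leb := (@lebesgue_measure R).
Local Notation D := (`]0, +oo[%classic : set R).
Context (g : T -> R -> R) (alpha beta : T -> R) (m : T -> R -> R).
Hypothesis alpha_ge0 : forall y, 0 <= alpha y.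
Hypothesis beta_ge0 : forall y, 0 <= beta y.
Hypothesis cm : forall y, completely_monotone (m y).
Hypothesis gE : forall y lambda, 0 < lambda ->
  ((g y lambda)%:E = (alpha y)%:E + (beta y * lambda)%:E +
    \int[leb]_(s in D) ((1 - expR (- (lambda * s))) * m y s)%:E)%E.
Hypothesis ig : forall lambda, 0 < lambda ->
  mu.-integrable setT (fun y => (g y lambda)%:E).

Let mg lambda : 0 < lambda -> measurable_fun setT (g ^~ lambda).
Proof. by move=> /ig /integrableP[/measurable_EFinP]. Qed.

(* Chosen so that e^(-ks) * w y s is the difference of the integrands of
   g y (k + 2) and g y (k + 1). *)
Let w y s := expR (- s) * (1 - expR (- s)) * m y s.

Let iw y : leb.-integrable D (EFin \o w y).
Proof.
have i1 := integrable_levy_integrand (cm y) (gE y) (@ltr01 R).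
have mexp : measurable_fun D (fun s : R => expR (- s)).
  by apply: measurableT_comp => //; exact: measurable_funN.
have exp1 (s : R) : 0 <= s -> `|expR (- s)| <= 1.
  by move=> s0; rewrite ger0_norm ?expR_ge0// expR_le1 oppr_le0.
rewrite (_ : w y = fun s => expR (- s) * ((1 - expR (- (1 * s))) * m y s)).
  exact: (integrable_boundedM mexp exp1 i1).
by apply/funext => s; rewrite /w mul1r mulrA.
Qed.

Let mm s : 0 < s -> measurable_fun setT (m ^~ s).
Proof.
move=> s0.
have c0 : expR (- s) * (1 - expR (- s)) != 0.
  by rewrite mulf_neq0 ?expR_eq0// subr_eq0 gt_eqF// expR_lt1 oppr_lt0.
rewrite (_ : m ^~ s = fun y => (expR (- s) * (1 - expR (- s)))^-1 * w y s); last first.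
  by apply/funext => y; rewrite /w mulKf.
apply: measurable_funM => //.
apply: (@measurable_density R _ T beta w iw) => //; last first.
  move=> y; have cms := @completely_monotone_continuous _ _ 0%N _ (cm y) s0.
  apply: cvgM; last exact: cms.
  have cexp : expR (- z) @[z --> s] --> expR (- s).
    apply: (@cvg_comp _ _ _ -%R expR); first exact: (@cvgN _ _ _ _ _ id s).
    exact: continuous_expR.
  by apply: cvgM => //; apply: cvgB => //; exact: cvg_cst.
(* In the difference of g y at k + 2 and k + 1, alpha cancels and the linear term leaves exactly
   beta y, the mass of the atom in the inversion formula. The shift by 1 keeps both arguments
   positive when k = 0. *)
move=> k; rewrite [X in measurable_fun _ X](_ : _ =
    (fun y => g y k.+2%:R - g y k.+1%:R)); last first.
  apply/funext => y; rewrite oppr0 expR0 expr1n mulr1.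
  have IntE l : 0 < l -> \int[leb]_(s in D) ((1 - expR (- (l * s))) * m y s) =
      g y l - (alpha y + beta y * l).
    by move=> l0; rewrite /Rintegral (levy_integral (gE y)).
  transitivity (beta y + (\int[leb]_(s in D) ((1 - expR (- (k.+2%:R * s))) * m y s)
    - \int[leb]_(s in D) ((1 - expR (- (k.+1%:R * s))) * m y s))).
    congr (_ + _); rewrite -RintegralB//; last 2 first.
    - exact: (integrable_levy_integrand (cm y) (gE y)).
    - exact: (integrable_levy_integrand (cm y) (gE y)).
    apply: eq_Rintegral => r _; rewrite /w -expRM_natl mulrN.
    rewrite -mulrBl mulrA; congr (_ * _).
    rewrite -!natr1 !mulrDl !mul1r !opprD !expRD; ring.
  rewrite !IntE// -!natr1; ring.
by apply: measurable_funB; exact: mg.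
Qed.

Let F lambda (z : T * measurableTypeR R) : \bar R :=
  (((fun z => ((1 - expR (- (lambda * z.2))) * m z.1 z.2)%:E) \_ (setT `*` D)) z)%E.

Let mF lambda : measurable_fun setT (F lambda).
Proof.
apply/(measurable_restrictT _ _).1; first exact: measurableX.
apply/measurable_EFinP; apply: measurable_funM.
  apply: (measurable_funS measurableT) => //.
  apply: measurable_funB => //; apply: measurableT_comp => //.
  by apply: measurable_funN; apply: measurable_funM.
apply: measurable_fun_caratheodory => // y s.
exact: (@completely_monotone_continuous _ _ 0%N).
Qed.

Let F_ge0 lambda z : 0 < lambda -> (0 <= F lambda z)%E.
Proof.
move=> l0; apply: erestrict_ge0 => -[y s] [_ /=]; rewrite in_itv/= andbT => s0.
by rewrite lee_fin; exact: levy_integrand_ge0.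
Qed.

Let F1 lambda y : (\int[leb]_s F lambda (y, s) =
  \int[leb]_(s in D) ((1 - expR (- (lambda * s))) * m y s)%:E)%E.
Proof.
rewrite [RHS]integral_mkcond; apply: eq_integral => s _.
rewrite /F !patchE; congr (if _ then _ else _).
by apply/idP/idP; rewrite !inE => //= -[].
Qed.

Let I lambda y := g y lambda - (alpha y + beta y * lambda).

Let IE lambda y : 0 < lambda -> (\int[leb]_s F lambda (y, s) = (I lambda y)%:E)%E.
Proof. by move=> l0; rewrite F1 (levy_integral (gE y)). Qed.

Let I_ge0 lambda y : 0 < lambda -> 0 <= I lambda y.
Proof.
by move=> l0; rewrite -lee_fin -IE//; apply: integral_ge0 => s _; exact: F_ge0.
Qed.

(** With m now jointly measurable, Tonelli's theorem gives the measurability of its integral in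
    s. *)
Let mI lambda : 0 < lambda -> measurable_fun setT (I lambda).
Proof.
move=> l0; apply/measurable_EFinP.
rewrite (_ : _ \o _ = fubini_F leb (F lambda)).
  by apply: measurable_fun_fubini_tonelli_F => // z; exact: F_ge0.
by apply/funext => y; rewrite /fubini_F IE.
Qed.

(** g - I is the affine function alpha + beta lambda, so its values at 1 and 2 determine beta, and
    then alpha. *)
Let mbeta : measurable_fun setT beta.
Proof.
rewrite (_ : beta = fun y => (g y 2 - I 2 y) - (g y 1 - I 1 y)).
  by do 2?apply: measurable_funB; first [exact: mg|exact: mI].
by apply/funext => y; rewrite /I; ring.
Qed.

Let malpha : measurable_fun setT alpha.
Proof.
rewrite (_ : alpha = fun y => (g y 1 - I 1 y) - beta y).
  by do 2?apply: measurable_funB => //; first [exact: mg|exact: mI].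
by apply/funext => y; rewrite /I; ring.
Qed.

(** To be applied to alpha, beta, I and m at a fixed s, each of which is a nonnegative part of g or
    controlled by such a part. *)
Let dominated_by_g (f : T -> R) (c lambda : R) : 0 < lambda -> measurable_fun setT f ->
  (forall y, 0 <= f y) -> (forall y, f y <= c * g y lambda) ->
  mu.-integrable setT (EFin \o f).
Proof.
move=> l0 mf f0 fg.
apply: (@le_integrable _ _ _ mu _ _ _ (fun y => c%:E * (g y lambda)%:E)%E) => //.
- exact/measurable_EFinP.
- move=> y _ /=; rewrite lee_fin ger0_norm// (le_trans (fg y))//.
  exact: ler_norm.
- by apply: integrableZl => //; exact: ig.
Qed.

Let ibeta : mu.-integrable setT (EFin \o beta).
Proof.
apply: (@dominated_by_g _ 1 1) => // y; have := I_ge0 y (@ltr01 R).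
by have := alpha_ge0 y; rewrite /I; lra.
Qed.

Let ialpha : mu.-integrable setT (EFin \o alpha).
Proof.
apply: (@dominated_by_g _ 1 1) => // y; have := I_ge0 y (@ltr01 R).
by have := beta_ge0 y; rewrite /I; lra.
Qed.

Let iI lambda : 0 < lambda -> mu.-integrable setT (EFin \o I lambda).
Proof.
move=> l0; apply: (@dominated_by_g _ 1 lambda) => //.
- exact: mI.
- by move=> y; exact: I_ge0.
- move=> y; rewrite mul1r /I gerBl addr_ge0// mulr_ge0//; exact: ltW.
Qed.

Let im s : 0 < s -> mu.-integrable setT (EFin \o m ^~ s).
Proof.
move=> s0; apply: (dominated_by_g ltr01).
- exact: mm.
- by move=> y; exact: completely_monotone_ge0.
- by move=> y; apply: (density_le _ _ (cm y) (gE y)).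
Qed.

Lemma complete_bernstein_Rintegral_density :
  complete_bernstein (fun lambda => \int[mu]_y g y lambda).
Proof.
exists (\int[mu]_y alpha y), (\int[mu]_y beta y), (fun s => \int[mu]_y m y s).
split.
- by apply: Rintegral_ge0.
- by apply: Rintegral_ge0.
- exact: completely_monotone_Rintegral.
move=> lambda l0.
have -> : \int[mu]_y g y lambda = \int[mu]_y alpha y + \int[mu]_y beta y * lambda +
    \int[mu]_y I lambda y.
  have ibl : mu.-integrable setT (EFin \o (fun y => beta y * lambda)).
    exact: (@integrableZr _ _ _ mu setT measurableT lambda _ ibeta).
  have iabl : mu.-integrable setT (EFin \o (fun y => alpha y + beta y * lambda)).
    exact: (integrableD measurableT ialpha ibl).
  rewrite -RintegralZr// -!RintegralD//; last exact: iI.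
  by apply: eq_Rintegral => y _; rewrite /I; ring.
rewrite !EFinD; congr (_ + _)%E.
rewrite /Rintegral fineK; last by apply: integrable_fin_num => //; exact: iI.
under eq_integral do rewrite -IE//.
(* After the exchange, the inner integral over y is the mixed density, up to the factor 1 -
   e^(-lambda s). *)
rewrite fubini_tonelli//; last by move=> z; exact: F_ge0.
rewrite [RHS]integral_mkcond; apply: eq_integral => s _.
rewrite patchE; case: ifPn => sD.
  have s0 : 0 < s by move: sD; rewrite inE/= in_itv/= andbT.
  transitivity (\int[mu]_y ((1 - expR (- (lambda * s)))%:E * (m y s)%:E))%E.
    apply: eq_integral => y _; rewrite /F patchE ifT ?EFinM//.
    by move: sD; rewrite !inE.
  rewrite integralZl//; last exact: im.
  by rewrite EFinM fineK//; apply: integrable_fin_num => //; exact: im.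
rewrite integral0_eq// => y _; rewrite /F patchE ifF//.
by apply/negbTE; apply: contra sD; rewrite !inE => -[].
Qed.

End complete_bernstein_mixture.

Lemma complete_bernstein_Rintegral (R : realType) d (T : measurableType d)
    (mu : {sigma_finite_measure set T -> \bar R}) (g : T -> R -> R) :
  (forall y, complete_bernstein (g y)) ->
  (forall lambda, 0 < lambda -> mu.-integrable setT (fun y => (g y lambda)%:E)) ->
  complete_bernstein (fun lambda => \int[mu]_y g y lambda).
Proof.
move=> /choice[alpha] /choice[beta] /choice[m] cb ig.
apply: (@complete_bernstein_Rintegral_density R d T mu g alpha beta m) => // y.
all: by have [] := cb y.
Qed.

(** * Poisson point processes *)

Section count_valued.
Context {R : realType} d (T : measurableType d) (P : {measure set T -> \bar R}).
Local Open Scope ereal_scope.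

(** [er_map expR] sends -oo to -oo, whereas [expeR] takes the value 0 there; the maximum with 0
    corrects this. *)
Lemma measurable_expeR : measurable_fun setT (@expeR R).
Proof.
rewrite (_ : expeR = fun x => maxe 0 (er_map expR x)).
  apply: (@measurable_maxe _ _ _ setT (cst 0) (er_map expR)) => //.
  apply: (@measurable_er_map _ (measurableTypeR R)).
  exact: measurable_expR.
by apply/funext => -[r| |]/=; rewrite ?maxNye ?maxeNy ?max_r ?leey// lee_fin expR_ge0.
Qed.

Lemma measurable_exp_count (X : T -> \bar R) (c : R) : measurable_fun setT X ->
  measurable_fun setT (fun w => expeR (- (c%:E * X w))).
Proof.
move=> mX; apply: measurableT_comp; first exact: measurable_expeR.
by apply: measurableT_comp => //; exact: measurable_funeM.
Qed.

Definition count_valued (X : T -> \bar R) :=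
  forall w, X w = +oo \/ exists k : nat, X w = k%:R%:E.

(** Decomposition along the values of X; as c > 0, the event X = +oo contributes nothing. G = 1
    gives the Laplace transform, while a general G serves the induction that proves independence of
    exponentials. *)
Lemma integral_exp_count (X G : T -> \bar R) (c : R) :
  measurable_fun setT X -> count_valued X -> (0 < c)%R ->
  measurable_fun setT G -> (forall w, 0 <= G w) ->
  \int[P]_w (expeR (- (c%:E * X w)) * G w) =
  \sum_(k <oo) (expR (- (c * k%:R)))%:E * \int[P]_(w in [set w | X w = k%:R%:E]) G w.
Proof.
move=> mX cX c0 mG G0.
pose F k := [set w | X w = k%:R%:E].
have mF k : measurable (F k).
  rewrite (_ : F k = X @^-1` [set k%:R%:E])//.
  by rewrite -[X in measurable X]setTI; exact: mX.
have mXG : measurable_fun setT (fun w => expeR (- (c%:E * X w)) * G w).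
  by apply: emeasurable_funM => //; exact: measurable_exp_count.
have mU : measurable (\bigcup_k F k) by exact: bigcupT_measurable.
have XG0 w : 0 <= expeR (- (c%:E * X w)) * G w by rewrite mule_ge0// expeR_ge0.
rewrite -(setUv (\bigcup_k F k)) ge0_integral_setU//=; last 3 first.
- exact: measurableC.
- by rewrite setUv.
- exact/disj_setPCl.
rewrite [X in _ + X](_ : _ = 0) ?adde0; last first.
  apply: integral0_eq => w nF; case: (cX w) => [->|[k Xk]].
    by rewrite gt0_muley ?lte_fin// mul0e.
  by exfalso; apply: nF; exists k.
rewrite ge0_integral_bigcup//; last 2 first.
- exact: measurable_funTS.
- apply/trivIsetP => i j _ _ ij; rewrite -subset0 => w [/= + Xj].
  by rewrite /F/= Xj => -[/eqP]; rewrite eqr_nat eq_sym (negPf ij).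
apply: eq_eseriesr => k _.
rewrite -ge0_integralZl//; last 2 first.
- exact: (mF k).
- exact: measurable_funTS.
by apply: eq_integral => w; rewrite inE/= => Xw; rewrite Xw -EFinM/= ?mulrN.
Qed.

Lemma poisson_exp_series (r c : R) : (0 <= r)%R ->
  \sum_(k <oo) (expR (- (c * k%:R)))%:E * (r ^+ k / k`!%:R * expR (- r))%:E =
  (expR (- (r * (1 - expR (- c)))))%:E.
Proof.
move=> r0.
transitivity (\sum_(k <oo) (expR (- r))%:E * (exp_coeff (r * expR (- c)) k)%:E).
  apply: eq_eseriesr => k _; rewrite -!EFinM /exp_coeff/=; congr EFin.
  by rewrite exprMn -expRM_natr mulNr; ring.
rewrite nneseriesZl; last first.
  by move=> k _; rewrite lee_fin exp_coeff_ge0// mulr_ge0// expR_ge0.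
have -> : \sum_(k <oo) (exp_coeff (r * expR (- c)) k)%:E = (expR (r * expR (- c)))%:E.
  apply/cvg_lim => //.
  under eq_fun do rewrite sumEFin.
  apply: cvg_EFin; first exact: nearW.
  exact: is_cvg_series_exp_coeff.
by rewrite -EFinM -expRD; congr (expR _)%:E; ring.
Qed.

End count_valued.

Section independent_counts.
Context {R : realType} d (T : measurableType d) (P : probability T R).
Local Open Scope ereal_scope.

Lemma expectation_exp_count (X : T -> \bar R) (c : R) :
  measurable_fun setT X -> count_valued X -> (0 < c)%R ->
  \int[P]_w expeR (- (c%:E * X w)) =
  \sum_(k <oo) (expR (- (c * k%:R)))%:E * P [set w | X w = k%:R%:E].
Proof.
move=> mX cX c0.
under eq_integral => w _ do rewrite -(mule1 (expeR _)).
rewrite (integral_exp_count P mX cX c0 (measurable_cst 1))//.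
apply: eq_eseriesr => k _; rewrite integral_cst ?mul1e//.
rewrite (_ : [set w | X w = k%:R%:E] = X @^-1` [set k%:R%:E])//.
by rewrite -[X in measurable X]setTI; exact: mX.
Qed.

Lemma poisson_laplace (X : T -> \bar R) (r : \bar R) (c : R) :
  measurable_fun setT X -> count_valued X -> 0 <= r ->
  poisson_distributed P X r -> (0 <= c)%R ->
  \int[P]_w expeR (- (c%:E * X w)) = expeR (- (r * (1 - expR (- c))%:E)).
Proof.
(* When c = 0 both sides equal 1, even for an infinite count or rate, since 0 times +oo is 0. *)
move=> mX cX r0 Xr; rewrite le_eqVlt => /predU1P[<-|c0].
  under eq_integral do rewrite mul0e oppe0 expeR0.
  by rewrite oppr0 expR0 subrr mule0 oppe0 expeR0 integral_cst//
    mul1e [LHS]probability_setT.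
rewrite expectation_exp_count//; case: r r0 Xr => [r|_|//].
  rewrite lee_fin /poisson_distributed => r0 Xr.
  by under eq_eseriesr do rewrite Xr; rewrite poisson_exp_series.
(* Infinite rate: X is almost surely infinite, and both sides vanish. *)
rewrite /poisson_distributed => Xoo.
have e1 : (0 < 1 - expR (- c))%R by rewrite subr_gt0 expR_lt1 oppr_lt0.
rewrite gt0_mulye ?lte_fin//= eseries0// => k _ _.
have mk (x : \bar R) : measurable (X @^-1` [set x]).
  by rewrite -[X in measurable X]setTI; exact: mX.
suff -> : P (X @^-1` [set k%:R%:E]) = 0 by rewrite mule0.
apply/eqP; rewrite -measure_le0.
have : P (~` (X @^-1` [set +oo])) = 0.
  by rewrite probability_setC// Xoo subee.
move=> <-; apply: le_measure; rewrite ?inE//; first exact: measurableC.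
by move=> w /= ->.
Qed.

Lemma independent_exp_counts n (X : 'I_n -> T -> \bar R) (c : 'I_n -> R) :
  (forall i, measurable_fun setT (X i)) -> (forall i, count_valued (X i)) ->
  independent_rvs P X -> (forall i, (0 <= c i)%R) ->
  \int[P]_w \prod_(i < n) expeR (- ((c i)%:E * X i w)) =
  \prod_(i < n) \int[P]_w expeR (- ((c i)%:E * X i w)).
Proof.
move=> mX cX indX c0.
(* The indicators of the definition of independence are turned into
   exponentials one at a time: induction on the set J of exponential factors. *)
pose psi (J : {set 'I_n}) (B : 'I_n -> set (\bar R)) i w : \bar R :=
  if i \in J then expeR (- ((c i)%:E * X i w)) else (\1_(B i) (X i w))%:E.
have psi_ge0 J B i w : 0 <= psi J B i w.
  by rewrite /psi; case: ifP => _; rewrite ?expeR_ge0// lee_fin.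
have mpsi J B i : measurable (B i) -> measurable_fun setT (psi J B i).
  move=> mBi; rewrite /psi; case: (i \in J); first exact: measurable_exp_count.
  apply/measurable_EFinP; apply: measurableT_comp (mX i).
  exact: measurable_indic.
have mprod J B (Q : pred 'I_n) : (forall i, measurable (B i)) ->
    measurable_fun setT (fun w => \prod_(i < n | Q i) psi J B i w).
  move=> mB; elim: (index_enum _) => [|i l ihl].
    by under eq_fun do rewrite big_nil; exact: measurable_cst.
  under eq_fun do rewrite big_cons; case: (Q i) => //.
  by apply: emeasurable_funM => //; exact: mpsi.
suff key k : forall (J : {set 'I_n}) (B : 'I_n -> set (\bar R)),
    #|J| = k -> (forall i, i \in J -> 0 < c i)%R ->
    (forall i, measurable (B i)) ->
    \int[P]_w \prod_(i < n) psi J B i w = \prod_(i < n) \int[P]_w psi J B i w.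
  (* Indices with c i = 0 are kept out of J: their factor is the constant 1, that is the indicator
     of [setT], and the expansion along the values of a count requires c i > 0. *)
  have psiT i w : psi [set i | (0 < c i)%R]%SET (fun=> setT) i w =
      expeR (- ((c i)%:E * X i w)).
    rewrite /psi inE; have := c0 i; rewrite le_eqVlt => /predU1P[<-|->//]; rewrite ltxx.
    by rewrite indicT mul0e oppe0 expeR0.
  pose K := @key _ [set i | (0 < c i)%R]%SET (fun=> setT) erefl.
  transitivity (\int[P]_w \prod_(i < n) psi [set i | (0 < c i)%R]%SET (fun=> setT) i w).
    by apply: eq_integral => w _; apply: eq_bigr => i _; rewrite psiT.
  rewrite K//; last by move=> i; rewrite inE.
  by apply: eq_bigr => i _; apply: eq_integral => w _; rewrite psiT.
elim: k => [|k ih] J B cardJ cJ mB.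
  move/cards0_eq : cardJ => J0.
  have psiE i w : psi J B i w = (\1_(X i @^-1` B i) w)%:E by rewrite /psi J0 inE.
  have mXB i : measurable (X i @^-1` B i).
    by rewrite -[X in measurable X]setTI; exact: mX.
  under [RHS]eq_bigr => i _ do under eq_integral do rewrite psiE.
  under [RHS]eq_bigr => i _ do rewrite integral_indic// setIT.
  rewrite -indX// -[X in P X]setIT -integral_indic//; last first.
    rewrite (_ : [set _ | _] = \bigcap_i (X i @^-1` B i)).
      by apply: fin_bigcap_measurable => // i _; exact: mXB.
    by apply/seteqP; split => [w h i _|w h i]; apply: h.
  apply: eq_integral => w _; under eq_bigr do rewrite psiE.
  rewrite indicE; case: (boolP (_ \in _)) => [|/negP]; rewrite inE/=.
    by move=> h; apply: big1 => i _; rewrite indicE mem_set//; exact: h.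
  by move=> /existsNP[i nBi]; rewrite (bigD1 i)//= indicE memNset// mul0e.
have /card_gt0P[j jJ] : (0 < #|J|)%N by rewrite cardJ.
(* Finiteness of the product of the other factors allows it to be moved inside the series over the
   values of X j. *)
have Ck : \prod_(i < n | i != j) \int[P]_w psi J B i w \is a fin_num.
  apply: prode_fin_num => i _; rewrite ge0_fin_numE; last exact: integral_ge0.
  apply: (@le_lt_trans _ _ (\int[P]_w (cst 1 w))); last first.
    by rewrite integral_cst// mul1e (le_lt_trans (probability_le1 _ _))// ltry.
  apply: ge0_le_integral => //; first exact: mpsi.
  move=> w _; rewrite /psi; case: ifPn => [_|_];
    last by rewrite lee_fin indicE lern1 leq_b1.
  rewrite -expeR0 lee_expeR oppe_le0 mule_ge0 ?lee_fin//.
  by case: (cX i w) => [->|[m ->]]; rewrite ?leey ?lee_fin.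
(* Restricting to X j = l turns the exponential factor of index j into an indicator; k exponential
   factors remain, and the induction hypothesis applies for every l. *)
pose B' l i := if i == j then [set l%:R%:E] else B i.
have psi' l i w : i != j -> psi (J :\ j)%SET (B' l) i w = psi J B i w.
  by move=> ij; rewrite /psi /B' !inE ij (negPf ij).
under eq_integral do rewrite (bigD1 j)//= {1}/psi jJ.
rewrite integral_exp_count//; last 3 first.
- exact: cJ.
- exact: mprod.
- by move=> w; apply: prode_ge0 => i _.
rewrite (bigD1 j)//= {2}/psi jJ expectation_exp_count//; last exact: cJ.
rewrite muleC -(fineK Ck) -nneseriesZl; last first.
  by move=> l _; rewrite mule_ge0// lee_fin expR_ge0.
apply: eq_eseriesr => l _; rewrite fineK// muleCA; congr (_ * _).
have mj : measurable [set w | X j w = l%:R%:E].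
  rewrite (_ : [set w | _] = X j @^-1` [set l%:R%:E])//.
  by rewrite -[X in measurable X]setTI; exact: mX.
transitivity (\int[P]_w \prod_(i < n) psi (J :\ j)%SET (B' l) i w).
  rewrite integral_mkcond; apply: eq_integral => w _.
  rewrite [RHS](bigD1 j)//= (_ : psi _ _ j w = (\1_[set l%:R%:E] (X j w))%:E).
    under [in RHS]eq_bigr => i ij do rewrite psi'//.
    rewrite indicE patchE.
    rewrite (_ : (X j w \in _) = (w \in [set w | X j w = l%:R%:E])).
      by case: (w \in _); rewrite ?mul1e ?mul0e.
    by apply/idP/idP; rewrite !inE.
  by rewrite /psi /B' !inE eqxx.
rewrite ih//; last 3 first.
- by have := cardsD1 j J; rewrite jJ cardJ => -[].
- by move=> i; rewrite !inE => /andP[_ /cJ].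
- by move=> i; rewrite /B'; case: ifP.
rewrite (bigD1 j)//= muleC; congr (_ * _).
  by apply: eq_bigr => i ij; apply: eq_integral => w _; exact: psi'.
rewrite (_ : (fun w => _) = (fun w => (\1_[set w | X j w = l%:R%:E] w)%:E)).
  by rewrite integral_indic// setIT.
apply/funext => w; rewrite /psi /B' !inE eqxx/= !indicE.
by congr (_%:R%:E); apply/idP/idP; rewrite !inE.
Qed.

End independent_counts.

(** * Sums over arbitrary index sets and functions of finite range *)

Section esum_complements.
Context {R : realType} {T : choiceType}.
Local Open Scope ereal_scope.

Lemma esum_cst (S : set T) (c : R) : (0 < c)%R ->
  \esum_(i in S) c%:E = c%:E * counting S.
Proof.
move=> c0.
have sumE (l : seq T) : (\sum_(i <- l) c = c * (size l)%:R)%R.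
  by rewrite big_const_seq count_predT iter_addr_0 mulr_natr.
rewrite /counting; case: asboolP => [finS|infS].
  rewrite esum_fset//; last by move=> i _; rewrite lee_fin ltW.
  by rewrite fsbig_finite//= sumEFin sumE -EFinM.
rewrite gt0_muley ?lte_fin//; apply/eqyP => A A0.
have [B BS nB] := infinite_set_fset (Num.truncn (A / c)).+1 infS.
apply: esum_ge; eexists; first by split; [exact: (finite_fset B)|exact: BS].
rewrite fsbig_finite//= set_fsetK sumEFin sumE lee_fin mulrC -ler_pdivrMr//.
by apply: le_trans (ltW (truncnS_gt _)) _; rewrite ler_nat.
Qed.

(** Monotone convergence: the supremum over finite subsets of S commutes with the supremum over n. S
    is going to be the uncountable set of times [0, t]. *)
Lemma cvg_esum (S : set T) (a_ : (T -> \bar R)^nat) (a : T -> \bar R) :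
  (forall n i, S i -> 0 <= a_ n i) ->
  (forall i, S i -> nondecreasing_seq (a_ ^~ i)) ->
  (forall i, S i -> a_ n i @[n --> \oo] --> a i) ->
  \esum_(i in S) a_ n i @[n --> \oo] --> \esum_(i in S) a i.
Proof.
move=> a0 nda cva.
have nds : nondecreasing_seq (fun n => \esum_(i in S) a_ n i).
  by move=> m n mn; apply: le_esum => i Si; exact: nda.
suff -> : \esum_(i in S) a i = ereal_sup (range (fun n => \esum_(i in S) a_ n i)).
  exact: ereal_nondecreasing_cvgn.
apply/eqP; rewrite eq_le; apply/andP; split.
  apply: ub_ereal_sup => _ [F [finF FS] <-].
  rewrite fsbig_finite//.
  set l := finmap.enum_fset (fset_set F).
  have lS i : i \in l -> S i by rewrite in_fset_set// inE => /FS.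
  have : \sum_(i <- l) a_ n i @[n --> \oo] --> \sum_(i <- l) a i.
    rewrite big_seq; under eq_fun do rewrite big_seq.
    apply: cvg_nnesum => i /lS Si; last exact: cva.
    by apply: nearW => n; exact: a0.
  move=> cvF; rewrite -(cvg_lim _ cvF)//; apply: lime_le; first by apply/cvg_ex;
    eexists; exact: cvF.
  apply: nearW => n; apply: le_trans (ereal_sup_ubound _); last by exists n.
  by apply: esum_ge; exists F => //; rewrite fsbig_finite.
apply: ub_ereal_sup => _ [n _ <-]; apply: le_esum => i Si.
have cvi := cva i Si; rewrite -(cvg_lim _ cvi)//.
rewrite (cvg_lim _ (ereal_nondecreasing_cvgn (nda i Si)))//.
by apply: ereal_sup_ubound; exists n.
Qed.

End esum_complements.

Section finite_range.
Context {R : realType} {T : Type} (h : {fimfun T >-> R}).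
Local Notation vals := (finmap.enum_fset (fset_set (range h))).

(** The values are indexed by ordinals to match the finite families in [independent_rvs] and
    [poisson_point_process]. *)
Lemma fimfun_compE (psi : R -> R) (x : T) :
  psi (h x) = \sum_(i < size vals) psi vals`_i * \1_(h @^-1` [set vals`_i]) x.
Proof.
have hx : h x \in vals by rewrite in_fset_set//= inE; exists x.
have lt_ix : (index (h x) vals < size vals)%N by rewrite index_mem.
rewrite (bigD1 (Ordinal lt_ix))//= nth_index// indicE mem_set//= mulr1.
rewrite big1 ?addr0// => i ix; rewrite indicE memNset ?mulr0//= => hxi.
move: ix => /eqP; apply; apply: val_inj => /=.
by rewrite hxi index_uniq//; exact: finmap.fset_uniq.
Qed.

Lemma fimfun_preimage_disjoint (i j : 'I_(size vals)) : i != j ->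
  h @^-1` [set vals`_i] `&` h @^-1` [set vals`_j] = set0.
Proof.
move=> ij; rewrite -subset0 => x [/= hi hj].
move/eqP: ij; apply; apply: val_inj.
apply: (uniqP 0 (finmap.fset_uniq (fset_set (range h))));
  [exact: (ltn_ord i)|exact: (ltn_ord j)|by rewrite -[LHS]hi].
Qed.

End finite_range.

Lemma expeRN_sum (R : realType) (I : Type) (r : seq I) (f : I -> \bar R) :
  (forall i, 0 <= f i)%E ->
  expeR (- \sum_(i <- r) f i)%E = (\prod_(i <- r) expeR (- f i))%E.
Proof.
move=> f0; elim: r => [|i r ih]; first by rewrite !big_nil oppe0 expeR0.
rewrite !big_cons -ih oppeD ?expeRD//.
by rewrite ge0_adde_def// inE ?f0// sume_ge0.
Qed.

(** * Campbell's formula for simple functions of the marks *)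

Section simple_point_functional.
Context {R : realType} d (T : measurableType d) (P : probability T R).
Context (e : R -> T -> \bar R) (kappa : set (\bar R) -> \bar R).
Hypothesis ppp : poisson_point_process P e kappa.
Hypothesis kappa0 : kappa set0 = 0%E.
Hypothesis kappa_ge0 : forall B, (0 <= kappa B)%E.
Context (t : R) (t_ge0 : 0 <= t).
Local Open Scope ereal_scope.
Import HBNNSimple.

Lemma point_count_valued A : count_valued (point_count e A).
Proof.
move=> w; rewrite /point_count /counting; case: ifP => _; last by left.
by right; eexists.
Qed.

Lemma intensity_strip (B : set (\bar R)) :
  intensity kappa (`[0%R, t]%classic `*` B) = t%:E * kappa (B `&` `]0, +oo]).
Proof.
rewrite /intensity.
transitivity (\int[lebesgue_measure]_(s in (`[0%R, t]%classic
  : set R)) (kappa (B `&` `]0, +oo]))).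
  rewrite integral_mkcond [RHS]integral_mkcond; apply: eq_integral => s _.
  rewrite !patchE; have [st|st] := boolP (s \in (`[0%R, t]%classic : set R)).
    rewrite in_xsectionX// ifT//.
    by move: st; rewrite !inE/= !in_itv/= andbT => /andP[].
  by rewrite notin_xsectionX// set0I kappa0 if_same.
rewrite integral_cst//= lebesgue_measure_itv/= lte_fin muleC.
case: ltgtP t_ge0 => // [t0 _|<- _]; last by rewrite !mul0e.
by rewrite -EFinD subr0.
Qed.

Context (h : {nnsfun (\bar R) >-> R}).
Hypothesis h0 : h 0 = 0%R.
Local Notation vals := (finmap.enum_fset (fset_set (range h))).

Let c (i : 'I_(size vals)) : R := vals`_i.
Let B i := h @^-1` [set c i].
Let A i : set (R * \bar R) := `[0%R, t]%classic `*` B i.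

Let c_ge0 i : (0 <= c i)%R.
Proof.
have : c i \in vals by exact: mem_nth.
by rewrite in_fset_set// inE => -[x _ <-].
Qed.

Let mA i : measurable (A i).
Proof. by apply: measurableX => //; exact: measurable_sfunP. Qed.

(** Since h 0 = 0, times without a point add nothing to the sum, and a nonzero value of h forces the
    positive mark required by [point_count]. *)
Lemma esum_simple_points w :
  \esum_(s in `[0%R, t]) (h (e s w))%:E =
    \sum_(i < size vals) (c i)%:E * point_count e (A i) w.
Proof.
have [e_ge0 _ _ _] := ppp.
transitivity (\esum_(s in `[0%R, t]) \sum_(i < size vals) (c i * \1_(B i) (e s w))%:E).
  by apply: eq_esum => s _; rewrite (fimfun_compE h id) sumEFin.
rewrite esum_sum; last by move=> s i _ _; rewrite lee_fin mulr_ge0// c_ge0.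
apply: eq_bigr => i _; have := c_ge0 i; rewrite le_eqVlt => /predU1P[<-|c0].
  by rewrite mul0e; apply: esum1 => s _; rewrite mul0r.
rewrite /point_count -esum_cst//.
rewrite (_ : [set s | [/\ _, _ & _]] = `[0%R, t]%classic `&` [set s | B i (e s w)]).
  rewrite esum_mkcondr; apply: eq_esum => s _.
  rewrite indicE (_ : (e s w \in B i) = (s \in [set s | B i (e s w)])).
    by case: ifP; rewrite ?mulr1 ?mulr0.
  by apply/idP/idP; rewrite !inE.
apply/seteqP; split => s /=; rewrite in_itv/=; first by move=> [_ _ []].
move=> [/andP[s0 st] Bi]; split => //; last by split => //; rewrite /= in_itv/= s0.
rewrite lt_neqAle e_ge0 andbT; apply/eqP => es.
by move: Bi c0; rewrite /B/= -es h0 => <-; rewrite ltxx.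
Qed.

(** The strips [0, t] x B i are disjoint, so their counts are independent Poisson variables with
    rates t kappa(B i), and the transform is a product of Poisson transforms. *)
Lemma laplace_simple_points (lambda : R) : (0 <= lambda)%R ->
  \int[P]_w expeR (- (lambda%:E * \esum_(s in `[0%R, t]) (h (e s w))%:E)) =
  expeR (- (t%:E * \sum_(i < size vals)
    (1 - expR (- (lambda * c i)))%:E * kappa (B i `&` `]0, +oo]))).
Proof.
move=> l0; have [e_ge0 mN poissonN indN] := ppp.
have N_ge0 i w : 0 <= point_count e (A i) w by exact: measure_ge0.
have lc i : (0 <= lambda * c i)%R by rewrite mulr_ge0// c_ge0.
transitivity (\int[P]_w \prod_(i < size vals)
    expeR (- ((lambda * c i)%:E * point_count e (A i) w))).
  apply: eq_integral => w _; rewrite esum_simple_points.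
  rewrite ge0_sume_distrr; last by move=> i _; rewrite mule_ge0// lee_fin c_ge0.
  rewrite expeRN_sum; last by move=> i; rewrite !mule_ge0// lee_fin c_ge0.
  by apply: eq_bigr => i _; rewrite muleA EFinM.
rewrite independent_exp_counts//; last 3 first.
- by move=> i; exact: mN.
- by move=> i; exact: point_count_valued.
- apply: indN => //; apply/trivIsetP => i j _ _ ij.
  by rewrite -setXI fimfun_preimage_disjoint// setX0.
transitivity (\prod_(i < size vals) expeR (- (t%:E * ((1 - expR (- (lambda * c i)))%:E *
   kappa (B i `&` `]0, +oo]))))).
  apply: eq_bigr => i _; rewrite (@poisson_laplace _ _ _ P _ (intensity kappa (A i)))//.
  - by rewrite intensity_strip -muleA (muleC (kappa _)).
  - exact: mN.
  - exact: point_count_valued.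
  - by rewrite intensity_strip mule_ge0.
  - exact: poissonN.
have k_ge0 i : 0 <= (1 - expR (- (lambda * c i)))%:E * kappa (B i `&` `]0, +oo]).
  by rewrite mule_ge0// lee_fin subr_ge0 expR_le1 oppr_le0.
rewrite -expeRN_sum; last by move=> i; rewrite mule_ge0.
by rewrite ge0_sume_distrr.
Qed.

End simple_point_functional.

(** * Integration against the mixed characteristic measure *)

Section mixed_characteristic_measure.
Context {R : realType} {E : ptopologicalType}.
Context (p : probability (borel E) R) (W : set (borel E)) (mW : measurable W).
Context (a : borel E -> R) (nu : R.-sigmafker (borel E) ~> (measurableTypeR R)).
Hypothesis a_ge0 : forall y, 0 <= a y.
Hypothesis ma : measurable_fun setT a.
Local Open Scope ereal_scope.
Local Notation kappa := (mixed_characteristic_measure p W a nu).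
Local Notation D := (`]0%R, +oo[%classic : set (measurableTypeR R)).
Import HBNNSimple.

Lemma mixed_characteristic_measure0 : kappa set0 = 0.
Proof.
apply: integral0_eq => y _.
by rewrite preimage_set0 measure0 add0e diracE in_set0 mule0.
Qed.

Lemma mixed_characteristic_measure_ge0 B : 0 <= kappa B.
Proof.
by apply: integral_ge0 => y _; rewrite adde_ge0// mule_ge0// lee_fin.
Qed.

(** The integral of phi over ]0, +oo] against nu(., y) + a(y) delta_oo, the measure averaged by
    [mixed_characteristic_measure]. *)
Definition characteristic_integral (phi : \bar R -> R) (y : borel E) : \bar R :=
  \int[nu y]_(s in D) (phi s%:E)%:E + (a y * phi +oo%E)%:E.

Lemma measurable_characteristic_integral (phi : \bar R -> R) :
  measurable_fun setT phi -> (forall x, 0 <= phi x)%R ->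
  measurable_fun setT (characteristic_integral phi).
Proof.
move=> mphi phi0; apply: emeasurable_funD; last first.
  by apply/measurable_EFinP; exact: measurable_funM.
under eq_fun do rewrite integral_mkcond.
apply: measurable_fun_integral_kernel => //.
- exact: measurable_kernel.
- by move=> s; apply: erestrict_ge0 => r _; rewrite lee_fin.
- apply/(measurable_restrictT _ _).1 => //; apply/measurable_EFinP.
  by apply: measurable_funTS; exact: measurableT_comp.
Qed.

(** [kappa] is handled as a mere set function, so the sum over the values of h plays the role of the
    integral of psi o h against it. Used with psi r = 1 - e^(-lambda r). *)
Lemma mixed_characteristic_measure_simple (h : {nnsfun (\bar R) >-> R}) (psi : R -> R) :
  (forall x, 0 <= psi (h x))%R ->
  \sum_(i < size (finmap.enum_fset (fset_set (range h))))
    (psi (finmap.enum_fset (fset_set (range h)))`_i)%:E *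
    kappa (h @^-1` [set (finmap.enum_fset (fset_set (range h)))`_i] `&` `]0, +oo]) =
  \int[p]_(y in W) characteristic_integral (psi \o h) y.
Proof.
move=> psi_ge0; set vals := finmap.enum_fset _.
have psi0 (i : 'I_(size vals)) : (0 <= psi vals`_i)%R.
  have : vals`_i \in vals by exact: mem_nth.
  by rewrite in_fset_set// inE => -[x _ <-].
pose B i := h @^-1` [set vals`_i] `&` `]0, +oo].
pose k i y := nu y (EFin @^-1` B i) + (a y)%:E * \d_(+oo) (B i).
have mB i : measurable (B i).
  by apply: measurableI; [exact: measurable_sfunP|exact: emeasurable_itv].
have mEB i : measurable (EFin @^-1` B i : set (measurableTypeR R)).
  by rewrite -[X in measurable X]setTI; exact: (@EFin_measurable R setT).
have mk i : measurable_fun W (k i).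
  apply: measurable_funTS; apply: emeasurable_funD; first exact: measurable_kernel.
  by apply: emeasurable_funM => //; exact/measurable_EFinP.
have k0 i y : 0 <= k i y by rewrite adde_ge0// mule_ge0// lee_fin.
transitivity (\int[p]_(y in W) \sum_(i < size vals) (psi vals`_i)%:E * k i y).
  rewrite ge0_integral_sum//; last 2 first.
  - by move=> i; apply: measurable_funeM.
  - by move=> i y _; rewrite mule_ge0// lee_fin.
  by apply: eq_bigr => i _; rewrite ge0_integralZl// lee_fin.
apply: eq_integral => y _; rewrite /characteristic_integral.
under eq_bigr do rewrite ge0_muleDr ?mule_ge0 ?lee_fin//.
rewrite big_split/=; congr (_ + _).
  transitivity (\int[nu y]_(s in D)
      \sum_(i < size vals) (psi vals`_i)%:E * (\1_(EFin @^-1` B i) s)%:E).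
    rewrite ge0_integral_sum//; last 2 first.
    - move=> i; apply: measurable_funeM; apply/measurable_EFinP.
      exact: measurable_indic.
    - by move=> i s _; rewrite mule_ge0// lee_fin.
    apply: eq_bigr => i _; rewrite ge0_integralZl ?lee_fin//; last first.
      by apply/measurable_EFinP; exact: measurable_indic.
    rewrite integral_indic// setIidl// => s [_ /=].
    by rewrite !in_itv/= leey lte_fin !andbT.
  apply: eq_integral => s; rewrite inE/= in_itv/= andbT => s0.
  rewrite (fimfun_compE h psi) -sumEFin; apply: eq_bigr => i _.
  rewrite EFinM !indicE; congr (_ * (_%:R)%:E).
  apply: (congr1 nat_of_bool); apply/idP/idP; rewrite !inE; first by case.
  by move=> hs; split => //=; rewrite in_itv/= leey lte_fin s0.
rewrite (fimfun_compE h psi) mulr_sumr -sumEFin; apply: eq_bigr => i _.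
rewrite diracE indicE mulrCA [RHS]EFinM EFinM; congr (_ * (_ * (_%:R)%:E)).
apply: (congr1 nat_of_bool); apply/idP/idP; rewrite !inE; first by case.
by move=> hs; split => //=; rewrite in_itv/= leey lt0y.
Qed.

End mixed_characteristic_measure.

(** Continuity of x |-> e^(-x) on [0, +oo], where the point +oo matters: killing and sums of
    infinitely many jumps produce infinite values. *)
Lemma cvg_expeRN {R : realType} (u_ : (\bar R)^nat) (u : \bar R) :
  (forall n, 0 <= u_ n)%E -> u_ n @[n --> \oo] --> u ->
  expeR (- u_ n)%E @[n --> \oo] --> expeR (- u)%E.
Proof.
move=> u0; case: u => [r| |] cvu.
- have [finu cvr] := (fine_cvgP _ _).1 cvu.
  have cve : (expR (- fine (u_ n)))%:E @[n --> \oo] --> (expR (- r))%:E.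
    apply: cvg_EFin; first exact: nearW.
    apply: continuous_cvg; first exact: continuous_expR.
    by apply: cvgN; exact: cvr.
  apply: cvg_trans cve; apply: near_eq_cvg.
  near=> n; have fu : u_ n \is a fin_num by near: n.
  by rewrite -[in RHS](fineK fu).
- apply/fine_cvgP; split.
    by apply: nearW => n; have := u0 n; case: (u_ n).
  apply/cvgrPdist_le => eps eps0; near=> n.
  have : ((- ln eps)%:E <= u_ n)%E by near: n; move/cvgeyPge : cvu; apply.
  have := u0 n; rewrite /= sub0r normrN; case: (u_ n) => [v _|_ _|//]/=.
    rewrite lee_fin => epsv; rewrite ger0_norm ?expR_ge0//.
    by rewrite -[leRHS]lnK ?posrE// ler_expR; lra.
  by rewrite normr0 ltW.
- have : (0 <= limn u_)%E by apply: lime_ge; [exact: cvgP cvu|exact: nearW].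
  by rewrite (cvg_lim _ cvu).
Unshelve. all: by end_near. Qed.

(** * Campbell's formula and the exponent of the distributed order subordinator *)

Section laplace_point_process.
Context {R : realType} {E : ptopologicalType}.
Context (p : probability (borel E) R) (W : set (borel E)) (mW : measurable W).
Context (a b : borel E -> R) (nu : R.-sigmafker (borel E) ~> (measurableTypeR R)).
Hypothesis a_ge0 : forall y, 0 <= a y.
Hypothesis b_ge0 : forall y, 0 <= b y.
Hypothesis ma : measurable_fun setT a.
Context d (T : measurableType d) (P : probability T R) (sigma : R ->
  {mfun T >-> \bar R}).
Hypothesis sigma_do : distributed_order_subordinator p W a b nu P sigma.
Local Open Scope ereal_scope.
Local Notation D := (`]0%R, +oo[%classic : set (measurableTypeR R)).
Import HBNNSimple.

(** Simple approximations of the absolute value, which is nonnegative on all of [\bar R] and is the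
    identity on [0, +oo], where e takes its values. *)
Let h n : {nnsfun (\bar R) >-> R} :=
  nnsfun_approx measurableT (@abse_measurable R setT) n.

Let cvg_h (x : \bar R) : 0 <= x -> (h n x)%:E @[n --> \oo] --> x.
Proof.
move=> x0; rewrite -[X in _ --> X](gee0_abs x0).
exact: (cvg_nnsfun_approx measurableT (@abse_measurable R setT)).
Qed.

Let nd_h (x : \bar R) : nondecreasing_seq (h ^~ x).
Proof. by move=> m n mn; exact/lefP/(nd_nnsfun_approx measurableT
  (@abse_measurable R setT)). Qed.

Let h0 n : h n 0 = 0%R.
Proof.
apply/eqP; rewrite eq_le fun_ge0 andbT -lee_fin.
have cv0 := cvg_h (lexx 0).
rewrite -[leRHS](cvg_lim _ cv0)//.
have nd0 : nondecreasing_seq (fun n => (h n 0)%:E).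
  by move=> m k mk; rewrite lee_fin nd_h.
rewrite (cvg_lim _ (ereal_nondecreasing_cvgn nd0))//.
by apply: ereal_sup_ubound; exists n.
Qed.

Let phi lambda n x := (1 - expR (- (lambda * h n x)))%R.

Let phi_ge0 lambda n x : (0 <= lambda)%R -> (0 <= phi lambda n x)%R.
Proof. by move=> l0; rewrite /phi subr_ge0 expR_le1 oppr_le0 mulr_ge0. Qed.

Let nd_phi lambda x : (0 <= lambda)%R -> nondecreasing_seq (phi lambda ^~ x).
Proof.
move=> l0 m n mn; rewrite /phi lerB// ler_expR lerN2 ler_wpM2l//.
exact: nd_h.
Qed.

Let mphi lambda n : measurable_fun setT (phi lambda n).
Proof.
apply: measurable_funB => //; apply: measurableT_comp => //.
by apply: measurable_funN; exact: measurable_funM.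
Qed.

Let cvg_phi lambda x : (0 <= lambda)%R -> 0 <= x ->
  (phi lambda n x)%:E @[n --> \oo] --> 1 - expeR (- (lambda%:E * x)).
Proof.
move=> l0 x0; under eq_fun do rewrite /phi EFinB.
apply: cvgeB; [exact: fin_num_adde_defr|exact: cvg_cst|].
rewrite (_ : (fun n => _) = (fun n => expeR (- (lambda%:E * (h n x)%:E))))//.
apply: cvg_expeRN; first by move=> n; rewrite mule_ge0// lee_fin.
by apply: cvgeZl => //; exact: cvg_h.
Qed.

(** f(lambda, y) without its drift term: a(y) comes from the atom at +oo, where 1 - e^(-lambda x)
    equals 1. *)
Definition levy_exponent (lambda : R) y : \bar R :=
  \int[nu y]_(s in D) (1 - expR (- (lambda * s)))%:E + (a y)%:E.

Let nd_charint lambda y : (0 <= lambda)%R ->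
  nondecreasing_seq (fun n => characteristic_integral a nu (phi lambda n) y).
Proof.
move=> l0 m n mn; rewrite /characteristic_integral leeD//; last first.
  by rewrite lee_fin ler_wpM2l// nd_phi.
apply: ge0_le_integral => //.
- by move=> s _; rewrite lee_fin phi_ge0.
- by apply/measurable_EFinP/measurable_funTS; exact: measurableT_comp.
- by apply/measurable_EFinP/measurable_funTS; exact: measurableT_comp.
- by move=> s _; rewrite lee_fin nd_phi.
Qed.

Let cvg_charint lambda y : (0 < lambda)%R ->
  characteristic_integral a nu (phi lambda n) y @[n --> \oo] --> levy_exponent lambda y.
Proof.
move=> l0; have l0' := ltW l0; apply: cvgeD.
- exact: fin_num_adde_defl.
- rewrite [X in _ --> X](_ : _ =
      \int[nu y]_(s in D) limn (fun n => (phi lambda n s%:E)%:E)).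
    apply: cvg_monotone_convergence => //.
    + by move=> n; apply/measurable_EFinP/measurable_funTS; exact: measurableT_comp.
    + by move=> n s _; rewrite lee_fin phi_ge0.
    + by move=> s _ m n mn; rewrite lee_fin nd_phi.
  apply: eq_integral => s; rewrite inE/= in_itv/= andbT => s0.
  apply/esym/cvg_lim => //.
  have := @cvg_phi lambda s%:E l0'; rewrite lee_fin => /(_ (ltW s0)).
  by rewrite -EFinM/= -EFinB.
- have -> : (a y)%:E = (a y)%:E * 1 by rewrite mule1.
  under eq_fun do rewrite EFinM.
  apply: cvgeZl => //; have := @cvg_phi lambda +oo l0' (leey _).
  by rewrite gt0_muley ?lte_fin//= sube0.
Qed.

Section poisson_points.
Context (e : R -> T -> \bar R) (t : R).
Hypothesis ppp : poisson_point_process P e (mixed_characteristic_measure p W a nu).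

Let S n w := \esum_(s in `[0%R, t]) (h n (e s w))%:E.

Let S_ge0 n w : 0 <= S n w.
Proof. by apply: esum_ge0 => s _; rewrite lee_fin. Qed.

Let cvgS w : S n w @[n --> \oo] --> \esum_(s in `[0%R, t]) e s w.
Proof.
have [e_ge0 _ _ _] := ppp; apply: cvg_esum => [n s _|s _ m n mn|s _].
- by rewrite lee_fin.
- by rewrite lee_fin nd_h.
- exact: cvg_h.
Qed.

(** The sum ranges over uncountably many times; it is measurable because it is a finite combination
    of point counts. *)
Let mS_ n : measurable_fun setT (S n).
Proof.
have [_ mN _ _] := ppp.
pose c := finmap.enum_fset (fset_set (range (h n))).
rewrite (_ : S n = (fun w => \sum_(i < size c) (c`_i)%:E *
    point_count e (`[0%R, t] `*` h n @^-1` [set c`_i]) w)); last first.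
  by apply/funext => w; exact: (esum_simple_points ppp t (h0 n)).
apply: (@emeasurable_sum _ _ _ setT _ _ (fun (i : 'I_(size c)) w => (c`_i)%:E *
  point_count e (`[0%R, t] `*` h n @^-1` [set c`_i]) w)) => i.
apply: measurable_funeM; apply: mN.
by apply: measurableX => //; exact: measurable_sfunP.
Qed.

Lemma measurable_esum_points : measurable_fun setT
  (fun w => \esum_(s in `[0%R, t]) e s w).
Proof. by apply: emeasurable_fun_cvg mS_ _ => w _; exact: cvgS. Qed.

(** Passage to the limit from simple functions: dominated convergence with bound 1 on the
    probability space, monotone convergence in s and then in y for the exponent. *)
Lemma laplace_points (lambda : R) : (0 <= t)%R -> (0 < lambda)%R ->
  \int[P]_w expeR (- (lambda%:E * \esum_(s in `[0%R, t]) e s w)) =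
  expeR (- (t%:E * \int[p]_(y in W) levy_exponent lambda y)).
Proof.
move=> t0 l0; have l0' := ltW l0.
have mkappa_ge0 := @mixed_characteristic_measure_ge0 R E p W a nu a_ge0.
have mkappa0 := @mixed_characteristic_measure0 R E p W a nu.
have SE n : \int[P]_w expeR (- (lambda%:E * S n w)) =
    expeR (- (t%:E * \int[p]_(y in W) characteristic_integral a nu (phi lambda n) y)).
  rewrite (laplace_simple_points ppp mkappa0 mkappa_ge0 t0 (h0 n) l0').
  have := @mixed_characteristic_measure_simple R E p W mW a nu a_ge0 ma (h n)
    (fun r => 1 - expR (- (lambda * r)))%R (fun x => phi_ge0 n x l0').
  by move=> ->.
have cvgL : \int[P]_w expeR (- (lambda%:E * S n w)) @[n --> \oo] -->
    \int[P]_w expeR (- (lambda%:E * \esum_(s in `[0%R, t]) e s w)).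
  have [] := @dominated_convergence _ _ _ P setT measurableT
    (fun n w => expeR (- (lambda%:E * S n w)))
    (fun w => expeR (- (lambda%:E * \esum_(s in `[0%R, t]) e s w))) (cst 1) => //.
  - by move=> n; exact: measurable_exp_count.
  - exact: (measurable_exp_count lambda measurable_esum_points).
  - apply: aeW => w _; apply: cvg_expeRN; first by move=> n; rewrite mule_ge0.
    by apply: cvgeZl => //; exact: cvgS.
  - exact: finite_measure_integrable_cst.
  - apply: aeW => w n _; rewrite gee0_abs ?expeR_ge0//.
    by rewrite -expeR0 lee_expeR oppe_le0 mule_ge0.
have cvgR : \int[P]_w expeR (- (lambda%:E * S n w)) @[n --> \oo] -->
    expeR (- (t%:E * \int[p]_(y in W) levy_exponent lambda y)).
  under eq_fun do rewrite SE.
  have ci0 n y : 0 <= characteristic_integral a nu (phi lambda n) y.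
    rewrite adde_ge0//; last by rewrite lee_fin mulr_ge0// phi_ge0.
    by apply: integral_ge0 => s _; rewrite lee_fin phi_ge0.
  apply: cvg_expeRN; first by move=> n; rewrite mule_ge0// integral_ge0.
  apply: cvgeZl => //.
  rewrite [X in _ --> X](_ : _ = \int[p]_(y in W)
      limn (fun n => characteristic_integral a nu (phi lambda n) y)).
    apply: cvg_monotone_convergence => //.
    + move=> n; apply: measurable_funTS;
      apply: measurable_characteristic_integral => //.
      by move=> x; exact: phi_ge0.
    + by move=> y _; exact: nd_charint.
  apply: eq_integral => y _; apply/esym/cvg_lim => //; exact: cvg_charint.
by rewrite -(cvg_lim _ cvgL)// (cvg_lim _ cvgR).
Qed.

End poisson_points.

Lemma laplace_distributed_order (t lambda : R) : (0 <= t)%R -> (0 < lambda)%R ->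
  \int[P]_w expeR (- (lambda%:E * sigma t w)) =
  expeR (- (t%:E * (lambda%:E * (\int[p]_(y in W) (b y)%:E) +
    \int[p]_(y in W) levy_exponent lambda y))).
Proof.
move=> t0 l0; have l0' := ltW l0; have [e ppp sigmaE] := sigma_do.
have [e_ge0 _ _ _] := ppp.
set beta := \int[p]_(y in W) (b y)%:E.
have beta0 : 0 <= beta by apply: integral_ge0 => y _; rewrite lee_fin.
have L0 : 0 <= \int[p]_(y in W) levy_exponent lambda y.
  apply: integral_ge0 => y _; rewrite adde_ge0 ?lee_fin//.
  apply: integral_ge0 => s; rewrite /= in_itv/= andbT => s0.
  by rewrite lee_fin subr_ge0 expR_le1 oppr_le0 mulr_ge0// ltW.
have ND (x y : \bar R) : 0 <= x -> 0 <= y ->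
    expeR (- (x + y)) = expeR (- x) * expeR (- y).
  by move=> x0 y0; rewrite oppeD ?expeRD// ge0_adde_def// inE.
transitivity (\int[P]_w (expeR (- (lambda%:E * (t%:E * beta))) *
    expeR (- (lambda%:E * \esum_(s in `[0%R, t]) e s w)))).
  apply: eq_integral => w _; rewrite sigmaE// ge0_muleDr ?mule_ge0//;
    last exact: esum_ge0.
  by rewrite ND// mule_ge0// ?mule_ge0//; exact: esum_ge0.
rewrite ge0_integralZl ?expeR_ge0//; last 2 first.
- exact: (measurable_exp_count lambda (measurable_esum_points t ppp)).
- by move=> w _; rewrite expeR_ge0.
have lb0 : 0 <= lambda%:E * beta by rewrite mule_ge0.
rewrite laplace_points// (ge0_muleDr t%:E lb0 L0) ND ?mule_ge0//.
by rewrite muleCA.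
Qed.

End laplace_point_process.

(** * Laplace transforms of transition probabilities *)

Section laplace_transition_prob.
Context {R : realType} d (T : measurableType d) (P : probability T R).
Context (X : {mfun T >-> \bar R}).
Local Open Scope ereal_scope.

(* The value -1 stands for the cemetery: it lies outside the support of
   [transition_prob P X]. *)
Let phi (w : T) : measurableTypeR R := if 0 <= X w < +oo then fine (X w) else (-1)%R.

Let mphi : measurable_fun setT phi.
Proof.
apply: measurable_fun_ifT => //.
  apply: measurable_and; last exact: measurable_fun_lte.
  by apply: measurable_fun_lee => //.
by apply: measurableT_comp.
Qed.

Let mphi_mixin := isMeasurableFun.Build _ _ _ _ _ mphi.
Let mphi_pack : {mfun T >-> measurableTypeR R} := HB.pack phi mphi_mixin.

Lemma laplace_transition_prob (lambda : R) : (0 < lambda)%R ->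
  {ae P, forall w, 0 <= X w} ->
  \int[transition_prob P X]_(x in `[0%R, +oo[) (expR (- (lambda * x)))%:E =
  \int[P]_w expeR (- (lambda%:E * X w)).
Proof.
move=> l0 X0.
have mexp : measurable_fun setT (fun x : R => (expR (- (lambda * x)))%:E).
  apply/measurable_EFinP; apply: measurableT_comp => //.
  by apply: measurable_funN; exact: measurable_funM.
have phiP w x : (0 <= x)%R -> phi w = x <-> X w = x%:E.
  move=> x0; rewrite /phi; case: ifPn => [/andP[h0 hoo]|h].
    have fX : X w \is a fin_num by rewrite ge0_fin_numE.
    by split => [<-|->//]; rewrite fineK.
  split => [xE|XE]; first by exfalso; move: x0; rewrite -xE; lra.
  by move: h; rewrite XE lee_fin x0 ltry.
(* The two measures are compared only on subsets of [0, +oo[, the domain of integration; the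
   pushforward also charges -1 when the process may be killed. *)
rewrite (@eq_measure_integral _ (measurableTypeR R) R _ (pushforward P mphi_pack));
  last first.
  move=> A mA A0; rewrite /= /transition_prob /pushforward; congr (P _).
  apply/seteqP; split => [w [x [Ax] x0 xX]|w Aw].
    by move: x0; rewrite /= in_itv/= andbT => x0; rewrite ((phiP w x x0).2 (esym xX)).
  have := A0 _ Aw; rewrite /= in_itv/= andbT => p0.
  exists (phi w); first by split => //=; rewrite in_itv/= andbT.
  by rewrite ((phiP w _ p0).1 erefl).
rewrite ge0_integral_pushforward//; last exact: measurable_funTS.
have mD : measurable (phi @^-1` `[0%R, +oo[).
  by rewrite -[X in measurable X]setTI; exact: mphi.
rewrite integral_mkcond; apply: ge0_ae_eq_integral => //.
- apply/(measurable_restrictT _ _).1 => //.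
  by apply: measurable_funTS; exact: (measurableT_comp mexp mphi).
- exact: measurable_exp_count.
- by move=> w _; apply: erestrict_ge0 => x _; rewrite lee_fin expR_ge0.
- by move=> w _; rewrite expeR_ge0.
apply: filterS X0 => w Xw _; rewrite patchE; case: ifPn.
  rewrite inE/= in_itv/= andbT => p0.
  by rewrite ((phiP w _ p0).1 erefl).
move=> /negP; rewrite inE/= in_itv/= andbT => nphi.
(* Off [0, +oo[ the restricted integrand is 0, and so is e^(-lambda X) at X = +oo, because lambda >
   0. *)
suff -> : X w = +oo by rewrite gt0_muley ?lte_fin.
case: (X w) Xw (phiP w) => [r| |//] //; rewrite lee_fin
  => r0 /(_ r r0)[_ /(_ erefl) pr].
by exfalso; apply: nphi; rewrite pr.
Qed.

End laplace_transition_prob.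

(** * The mean Bernstein function *)

Section mean_bernstein.
Context {R : realType} {E : ptopologicalType}.
Context (p : probability (borel E) R) (W : set (borel E)) (mW : measurable W).
Hypothesis pW : p W = 1%E.
Context (a b : borel E -> R) (nu : R.-sigmafker (borel E) ~> (measurableTypeR R)).
Hypothesis a_ge0 : forall y, 0 <= a y.
Hypothesis b_ge0 : forall y, 0 <= b y.
Hypothesis ma : measurable_fun setT a.
Hypothesis mb : measurable_fun setT b.
Local Open Scope ereal_scope.
Local Notation D := (`]0%R, +oo[%classic : set (measurableTypeR R)).

Let levy_integral_nu lambda y := \int[nu y]_(s in D) (1 - expR (- (lambda * s)))%:E.

Let L_ge0 lambda y : (0 < lambda)%R -> 0 <= levy_integral_nu lambda y.
Proof.
move=> l0; apply: integral_ge0 => s; rewrite /= in_itv/= andbT => s0.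
by rewrite lee_fin subr_ge0 expR_le1 oppr_le0 mulr_ge0// ltW.
Qed.

Let measurable_kernel_integral (f : R -> R) : measurable_fun D f ->
  (forall s, 0 < s -> 0 <= f s)%R ->
  measurable_fun setT (fun y => \int[nu y]_(s in D) (f s)%:E).
Proof.
move=> mf f0; under eq_fun do rewrite integral_mkcond.
apply: measurable_fun_integral_kernel => //.
- exact: measurable_kernel.
- move=> s; apply: erestrict_ge0 => r; rewrite /= in_itv/= andbT lee_fin.
  exact: f0.
- by apply/(measurable_restrictT _ _).1 => //; exact/measurable_EFinP.
Qed.

Let mL lambda : (0 < lambda)%R -> measurable_fun setT (levy_integral_nu lambda).
Proof.
move=> l0; apply: measurable_kernel_integral => [|s s0].
  apply: measurable_funB => //; apply: measurableT_comp => //.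
  by apply: measurable_funN; exact: measurable_funM.
by rewrite subr_ge0 expR_le1 oppr_le0 mulr_ge0// ltW.
Qed.

Lemma measurable_bernstein_fun lambda : (0 < lambda)%R ->
  measurable_fun setT (fun y => bernstein_fun (a y) (b y) (nu y) lambda).
Proof.
move=> l0; apply: emeasurable_funD; last exact: mL.
apply: emeasurable_funD; apply/measurable_EFinP => //.
exact: measurable_funM.
Qed.

Lemma bernstein_fun_ge0 lambda y : (0 < lambda)%R ->
  0 <= bernstein_fun (a y) (b y) (nu y) lambda.
Proof.
move=> l0; apply: adde_ge0; last exact: L_ge0.
by rewrite adde_ge0// lee_fin// mulr_ge0// ltW.
Qed.

(** The mixture of Bernstein functions is taken over all of E and the characteristics of the
    subordinator over W; the complement of W is negligible. *)
Lemma integral_bernstein_fun lambda : (0 < lambda)%R ->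
  \int[p]_y bernstein_fun (a y) (b y) (nu y) lambda =
  lambda%:E * (\int[p]_(y in W) (b y)%:E)
    + \int[p]_(y in W) levy_exponent a nu lambda y.
Proof.
move=> l0; have l0' := ltW l0.
have pWC : p (~` W) = 0 by rewrite probability_setC// pW subee.
rewrite (ge0_negligible_integral (measurableC mW))//; last 2 first.
- exact: measurable_bernstein_fun.
- by move=> y _; exact: bernstein_fun_ge0.
rewrite setDE setCK setTI.
rewrite -ge0_integralZl//; last 2 first.
- by apply: measurable_funTS; exact/measurable_EFinP.
- by move=> y _; rewrite lee_fin.
rewrite -ge0_integralD//; last 4 first.
- by move=> y _; rewrite mule_ge0// lee_fin.
- by apply: measurable_funTS; apply: measurable_funeM; exact/measurable_EFinP.
- by move=> y _; rewrite adde_ge0 ?lee_fin//; exact: L_ge0.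
- apply: measurable_funTS; apply: emeasurable_funD; first exact: mL.
  exact/measurable_EFinP.
apply: eq_integral => y _; rewrite /bernstein_fun /levy_exponent.
by rewrite -EFinM (mulrC lambda) -addeA addeC -addeA.
Qed.

Let mtrunc : measurable_fun D (fun s => (Num.min s 1)%:E).
Proof. by apply/measurable_EFinP; apply: measurable_minr. Qed.

(** The constant comes from 1 - e^(-u) <= min(u, 1) at u = lambda s, which is at most (1 + lambda)
    min(s, 1) both for s < 1 and for s >= 1. *)
Lemma bernstein_fun_le lambda y : (0 < lambda)%R ->
  bernstein_fun (a y) (b y) (nu y) lambda <=
  (a y)%:E + lambda%:E * (b y)%:E + (1 + lambda)%:E * truncated_mean (nu y).
Proof.
move=> l0; have l0' := ltW l0; rewrite /bernstein_fun -EFinM (mulrC lambda) leeD2l//.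
rewrite /truncated_mean -ge0_integralZl//; last 2 first.
- by move=> s; rewrite /= in_itv/= andbT => s0; rewrite lee_fin le_min ltW//= ler01.
- by rewrite lee_fin addr_ge0.
apply: ge0_le_integral => //.
- move=> s; rewrite /= in_itv/= andbT => s0.
  by rewrite lee_fin subr_ge0 expR_le1 oppr_le0 mulr_ge0// ltW.
- apply/measurable_EFinP; apply: measurable_funB => //; apply: measurableT_comp => //.
  by apply: measurable_funN; exact: measurable_funM.
- by apply: measurable_funeM; exact: mtrunc.
move=> s; rewrite /= in_itv/= andbT => s0; rewrite -EFinM lee_fin.
have := expR_ge0 (- (lambda * s)); have := expR_ge1Dx (- (lambda * s)).
have ls : (0 <= lambda * s)%R by rewrite mulr_ge0// ltW.
by rewrite /Num.min; case: ifP => _; nra.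
Qed.

Lemma integral_bernstein_fun_lty lambda : (0 < lambda)%R ->
  (exists C : R, forall y, a y <= C /\ b y <= C)%R \/
    (\int[p]_(y in W) (a y)%:E < +oo /\ \int[p]_(y in W) (b y)%:E < +oo) ->
  (exists C : R, forall y, truncated_mean (nu y) <= C%:E) \/
    \int[p]_(y in W) truncated_mean (nu y) < +oo ->
  \int[p]_y bernstein_fun (a y) (b y) (nu y) lambda < +oo.
Proof.
move=> l0 A1 A2; have l0' := ltW l0.
have mV : measurable_fun setT (fun y => truncated_mean (nu y)).
  apply: measurable_kernel_integral => [|s s0]; first exact: measurable_minr.
  by rewrite le_min ltW//= ler01.
have V_ge0 y : 0 <= truncated_mean (nu y).
  apply: integral_ge0 => s; rewrite /= in_itv/= andbT => s0.
  by rewrite lee_fin le_min ltW//= ler01.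
have bounded_lty (f : borel E -> \bar R) (C : R) : measurable_fun setT f ->
    (forall y, 0 <= f y) -> (forall y, f y <= C%:E) -> \int[p]_(y in W) f y < +oo.
  move=> mf f0 fC; apply: (@le_lt_trans _ _ (\int[p]_(y in W) C%:E)).
    by apply: ge0_le_integral => //; exact: measurable_funTS.
  by rewrite integral_cst// [X in (_ * X)]pW mule1 ltry.
have aoo : \int[p]_(y in W) (a y)%:E < +oo.
  case: A1 => [[C aC]|[]//]; apply: (bounded_lty _ C).
  - exact/measurable_EFinP.
  - by move=> y; rewrite lee_fin.
  - by move=> y; rewrite lee_fin; have [] := aC y.
have boo : \int[p]_(y in W) (b y)%:E < +oo.
  case: A1 => [[C bC]|[]//]; apply: (bounded_lty _ C).
  - exact/measurable_EFinP.
  - by move=> y; rewrite lee_fin.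
  - by move=> y; rewrite lee_fin; have [] := bC y.
have Voo : \int[p]_(y in W) truncated_mean (nu y) < +oo.
  by case: A2 => [[C VC]|//]; exact: (bounded_lty _ C).
have pWC : p (~` W) = 0 by rewrite probability_setC// pW subee.
rewrite (ge0_negligible_integral (measurableC mW))//; last 2 first.
- exact: measurable_bernstein_fun.
- by move=> y _; exact: bernstein_fun_ge0.
rewrite setDE setCK setTI.
apply: (@le_lt_trans _ _ (\int[p]_(y in W) ((a y)%:E + lambda%:E * (b y)%:E +
    (1 + lambda)%:E * truncated_mean (nu y)))).
  apply: ge0_le_integral => //.
  - by move=> y _; exact: bernstein_fun_ge0.
  - by apply: measurable_funTS; exact: measurable_bernstein_fun.
  - apply: measurable_funTS; apply: emeasurable_funD; last exact: measurable_funeM.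
    apply: emeasurable_funD; first exact/measurable_EFinP.
    by apply: measurable_funeM; exact/measurable_EFinP.
  - by move=> y _; exact: bernstein_fun_le.
have mW_ (f : borel E -> \bar R) : measurable_fun setT f -> measurable_fun W f.
  exact: measurable_funTS.
have maE : measurable_fun W (fun y => (a y)%:E) by apply: mW_; exact/measurable_EFinP.
have mbE : measurable_fun W (fun y => (b y)%:E) by apply: mW_; exact/measurable_EFinP.
rewrite ge0_integralD//; last 4 first.
- by move=> y _; rewrite adde_ge0 ?mule_ge0 ?lee_fin.
- by apply: emeasurable_funD => //; exact: measurable_funeM.
- by move=> y _; rewrite mule_ge0// lee_fin addr_ge0.
- by apply: measurable_funeM; exact: mW_.
rewrite ge0_integralD//; last 3 first.
- by move=> y _; rewrite lee_fin.
- by move=> y _; rewrite mule_ge0 ?lee_fin.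
- exact: measurable_funeM.
have l10 : 0 <= (1 + lambda)%:E by rewrite lee_fin addr_ge0.
have b0 y : W y -> 0 <= (b y)%:E by rewrite lee_fin.
rewrite (ge0_integralZl p mW (mW_ _ mV) (fun y _ => V_ge0 y) l10).
rewrite (ge0_integralZl p mW mbE b0)//.
by apply: lte_add_pinfty; [apply: lte_add_pinfty => //|]; apply: lte_mul_pinfty.
Qed.

End mean_bernstein.

Theorem proposition2p3 (R : realType) (E : ptopologicalType)
    (polishE : polish_space R E)
    (W : set (borel E)) (mW : measurable W)
    (p : probability (borel E) R) (pW : p W = 1%E)
    (a b : borel E -> R)
    (nu : R.-sigmafker (borel E) ~> (measurableTypeR R))
    (a_ge0 : forall y, 0 <= a y) (b_ge0 : forall y, 0 <= b y)
    (nu_pos : forall y, nu y `]-oo, 0]%classic = 0%E)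
    (V_fin : forall y, (truncated_mean (nu y) < +oo)%E)
    (A1_meas : measurable_fun setT a /\ measurable_fun setT b)
    (A1 : (exists C : R, forall y, a y <= C /\ b y <= C) \/
          ((\int[p]_(y in W) (a y)%:E < +oo)%E /\
           (\int[p]_(y in W) (b y)%:E < +oo)%E))
    (A2 : (exists C : R, forall y, (truncated_mean (nu y) <= C%:E)%E) \/
          (\int[p]_(y in W) truncated_mean (nu y) < +oo)%E)
    (dY : measure_display) (OmegaY : E -> measurableType dY)
    (PY : forall y, probability (OmegaY y) R)
    (sigmaY : forall y, R -> {mfun OmegaY y >-> \bar R})
    (sigmaY_sub : forall y, subordinator (PY y) (sigmaY y))
    (sigmaY_exp : forall y, has_laplace_exponent (PY y) (sigmaY y)
                              (bernstein_fun (a y) (b y) (nu y)))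
    (dp : measure_display) (Omegap : measurableType dp)
    (Pp : probability Omegap R)
    (sigmap : R -> {mfun Omegap >-> \bar R})
    (sigmap_do : distributed_order_subordinator p W a b nu Pp sigmap)
    (t : R) (t_ge0 : 0 <= t) :
  (forall y, BO (transition_prob (PY y) (sigmaY y t))) ->
  BO (transition_prob Pp (sigmap t)).
Proof.
have [ma mb] := A1_meas.
move=> BOY; pose f y lambda := bernstein_fun (a y) (b y) (nu y) lambda.
(* Equating the two expressions of the Laplace transform of sigmaY y t identifies the exponent given
   by [BO] with t f(., y). Keeping t inside g also covers t = 0, where f cannot be recovered from
   the transform. *)
have gP y : exists g, complete_bernstein g /\
    forall lambda, 0 < lambda -> (g lambda)%:E = (t%:E * f y lambda)%E.
  have [_ _ [g cbg gE]] := BOY y; exists g; split => // lambda l0.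
  have := gE _ l0; rewrite laplace_transition_prob//.
    rewrite sigmaY_exp// => /(@expeR_inj R _ (- (g lambda))%:E)/esym/eqP.
    by rewrite EFinN eqe_opp => /eqP.
  have [+ _] := sigmaY_sub y; apply: filterS => w [s0 mono _].
  by rewrite -s0; apply: mono.
have {gP} [g /all_and2[cbg gE]] := choice gP.
have intg lambda : 0 < lambda -> (\int[p]_y (g y lambda)%:E =
    t%:E * \int[p]_y f y lambda)%E.
  move=> l0; under eq_integral do rewrite gE//.
  rewrite ge0_integralZl//.
  - exact: measurable_bernstein_fun.
  - by move=> y _; exact: bernstein_fun_ge0.
have foo lambda : 0 < lambda -> (\int[p]_y f y lambda < +oo)%E.
  by move=> l0; exact: (integral_bernstein_fun_lty mW pW).
have ig lambda : 0 < lambda -> p.-integrable setT (fun y => (g y lambda)%:E).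
  move=> l0.
  have g0 y : (0 <= (g y lambda)%:E)%E.
    by rewrite gE// mule_ge0//; exact: bernstein_fun_ge0.
  apply/integrableP; split.
    under eq_fun do rewrite gE//.
    by apply: measurable_funeM; exact: measurable_bernstein_fun.
  under eq_integral do rewrite gee0_abs//.
  by rewrite intg// lte_mul_pinfty// foo.
split.
- rewrite /= /transition_prob (_ : _ @^-1` _ = set0) ?measure0//.
  rewrite -subset0 => w [x [/=]]; rewrite !in_itv/= andbT => x0.
  by rewrite leNgt x0.
- rewrite /= /transition_prob; apply: probability_le1.
  rewrite -[X in measurable X]setTI; apply: measurable_funPT => //.
  by apply: measurable_image_EFin; exact: measurableI.
(* The exponent of the mixture is t times the mean Bernstein function, finite by the bounds on a, b
   and the truncated means. *)
exists (fun lambda => \int[p]_y g y lambda).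
  exact: complete_bernstein_Rintegral.
move=> lambda l0; have [e [e_ge0 _ _ _] sigmaE] := sigmap_do.
rewrite laplace_transition_prob//; last first.
  apply: aeW => w; rewrite sigmaE// adde_ge0//; last exact: esum_ge0.
  by rewrite mule_ge0//; apply: integral_ge0 => y _; rewrite lee_fin.
rewrite (laplace_distributed_order mW a_ge0 b_ge0 ma sigmap_do)//.
rewrite -integral_bernstein_fun// -intg// /Rintegral.
by rewrite -[in LHS](fineK (integrable_fin_num measurableT (ig _ l0))).
Qed.
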